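(* Let $A,B\in G$ and write $f(x)=\sum_{p=1}^\infty a_px^p$. If $Y=(Y_1,\dots,Y_n)\in G^n$ is a fixed point of the frustrated system $$X_i'X_i^{-1}=\Omega_i+\frac12\sum_{j=1}^n\gamma_{ij}\bigl(g(BX_jX_i^{-1}A^{-1})-g(BA^{-1})\bigr),\qquad g(Z)=f(Z)-f(Z^{-1}),$$ then the linearization of the flow around $Y$ is given by the linear operator $\mathcal L_Y:\mathfrak g_0^n\to\mathfrak g_0^n$, $$(\mathcal L_YQ)_i=\sum_{j=1}^n\gamma_{ij}\,\mathcal L_{Y,ij}(Q_j-Q_i),$$ where $$\mathcal L_{Y,ij}W=\frac12\sum_{p=1}^\infty a_p\Bigl\{(Y_i^{-1}BY_j)\Bigl(\sum_{q=0}^{p-1}(BY_jY_i^{-1}A^{-1})^qW(BY_jY_i^{-1}A^{-1})^{p-q-1}\Bigr)(Y_i^{-1}A^{-1}Y_i)$$ $$\qquad\qquad+(Y_i^{-1}AY_i)\Bigl(\sum_{q=0}^{p-1}(Y_j^{-1}B^{-1}AY_i)^qW(AY_iY_j^{-1}B^{-1})^{p-q-1}\Bigr)(Y_j^{-1}B^{-1}Y_i)\Bigr\}.$$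
   Context: Let $G$ be a matrix Lie group (closed subgroup of the general linear group over $\mathbb R$ or $\mathbb C$) with Lie algebra $\mathfrak g$, with the Lohe closure property: $Z-Z^{-1}\in\mathfrak g$ for all $Z\in G$. Let $\gamma_{ij}=\gamma_{ji}\ge 0$ be the edge weights of an undirected weighted graph on $n$ vertices, let $\Omega=(\Omega_1,\dots,\Omega_n)\in\mathfrak g^n$, and let $f$ be a real analytic function, applied to elements of $G$ through its power series. Put $\mathfrak g_0^n=\{(Q_1,\dots,Q_n)\in\mathfrak g^n:\sum_{i=1}^nQ_i=0\}$. A fixed point is a solution with $X_i'=0$ for all $i$. The linearization of the flow around $Y$ is taken in the coordinates $X_i=Y_i\exp(\epsilon Q_i)$, $Q_i\in\mathfrak g$: it is the equation $Q'=\mathcal L_YQ$ obtained from the system at first order in $\epsilon$.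
   Formalization: The powers around W are taken of Y_i^{-1}A^{-1}BY_j and its inverse Y_j^{-1}B^{-1}AY_i (the printed bases fail for noncommuting matrices, e.g. SU(2), f=x^2), and L_Y maps g_0^n to g^n, since its values need not sum to zero. *)

(* Defs.v *)
From HB Require Import structures.
From mathcomp Require Import all_boot all_order all_algebra complex.
From mathcomp Require Import all_classical all_reals all_analysis.
Import numFieldNormedType.Exports.
Import Order.TTheory GRing.Theory Num.Theory.

Set Implicit Arguments.
Unset Strict Implicit.
Unset Printing Implicit Defensive.

Local Open Scope classical_set_scope.
Local Open Scope ring_scope.

(* Matrices have entries in [scalars R cplx]: the field R of real numbers if
   [cplx = false], the field R[i] of complex numbers if [cplx = true].  Time,
   the small parameter, the edge weights and the coefficients of f are real. *)
Definition scalars (R : realType) (cplx : bool) : numFieldType :=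
  if cplx then (R[i] : numFieldType) else (R : numFieldType).

Definition of_real (R : realType) (cplx : bool) : R -> scalars R cplx :=
  if cplx return R -> scalars R cplx then @real_complex R else id.

Section LoheModel.
Context {R : realType} {cplx : bool} {d n : nat}.

Local Notation M := ('M[scalars R cplx]_d.+1).
Local Notation "x %:S" := (@of_real R cplx x) (at level 2, format "x %:S").

Definition mexp (Z : M) : M :=
  limn (fun N : nat => \sum_(0 <= k < N) (k`!%:R)^-1 *: Z ^+ k).

(* The derivative of a curve is spelled out as a limit of difference quotients
   because M is a normed space over its scalars, which need not be R. *)
Definition mderiv (X : R -> M) (t : R) (D : M) : Prop :=
  (fun h : R => (h^-1)%:S *: (X (t + h) - X t)) @ 0^' --> D.

Record matrix_lie_group (G : set M) : Prop := MatrixLieGroup {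
  mlg_unit : forall Z, G Z -> Z \is a GRing.unit;
  mlg_one : G 1;
  mlg_mul : forall Z W, G Z -> G W -> G (Z * W);
  mlg_inv : forall Z, G Z -> G Z^-1;
  (* G is closed in the general linear group, not necessarily in M. *)
  mlg_closed : forall Z, Z \is a GRing.unit -> closure G Z -> G Z }.

Definition lie_algebra (G : set M) : set M :=
  [set Q : M | forall t : R, G (mexp (t%:S *: Q))].

Definition lohe_closed (G : set M) : Prop :=
  forall Z, G Z -> lie_algebra G (Z - Z^-1).

Definition lie_algebra_n (G : set M) : set ('I_n -> M) :=
  [set Q : 'I_n -> M | forall i, lie_algebra G (Q i)].

Definition lie_algebra_n0 (G : set M) : set ('I_n -> M) :=
  [set Q : 'I_n -> M | lie_algebra_n G Q /\ \sum_i Q i = 0].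

Definition pseries_mx (a : nat -> R) (Z : M) : nat -> M :=
  fun N : nat => \sum_(1 <= p < N) (a p)%:S *: Z ^+ p.

Definition f_mx (a : nat -> R) (Z : M) : M := limn (pseries_mx a Z).

(* Convergence is required near Z, and not only at Z, so that the spectrum of Z
   lies in the open disc of convergence, where f is analytic. *)
Definition analytic_on (a : nat -> R) (G : set M) : Prop :=
  forall Z, G Z -> \forall W \near Z, cvgn (pseries_mx a W).

Definition g_mx (a : nat -> R) (Z : M) : M := f_mx a Z - f_mx a Z^-1.

(* The right-hand side of X_i' X_i^-1 = ... *)
Definition frustrated_lohe (gamma : 'I_n -> 'I_n -> R) (Omega : 'I_n -> M)
    (a : nat -> R) (A B : M) (X : 'I_n -> M) (i : 'I_n) : M :=
  Omega i + (2^-1)%:S *: \sum_j (gamma i j)%:S *: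
    (g_mx a (B * X j * (X i)^-1 * A^-1) - g_mx a (B * A^-1)).

Definition is_solution (G : set M) (V : ('I_n -> M) -> 'I_n -> M)
    (X : R -> 'I_n -> M) : Prop :=
  forall t i, G (X t i) /\
    exists2 D, mderiv (X ^~ i) t D & D * (X t i)^-1 = V (X t) i.

Definition fixed_point (G : set M) (V : ('I_n -> M) -> 'I_n -> M)
    (Y : 'I_n -> M) : Prop :=
  is_solution G V (fun=> Y).

Definition exp_coord (Y : 'I_n -> M) (Q : R -> 'I_n -> M) (eps t : R)
    (i : 'I_n) : M :=
  Y i * mexp (eps%:S *: Q t i).

(* X_i = Y_i exp(eps Q_i) satisfies X_i' X_i^-1 = V_i(X) at time t up to an
   error o(eps). *)
Definition first_order_solution (V : ('I_n -> M) -> 'I_n -> M)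
    (Y : 'I_n -> M) (Q : R -> 'I_n -> M) (t : R) : Prop :=
  exists2 dX : R -> 'I_n -> M,
    forall eps i, mderiv (fun s => exp_coord Y Q eps s i) t (dX eps i) &
    forall i, (fun eps : R => (eps^-1)%:S *:
      (dX eps i * (exp_coord Y Q eps t i)^-1 - V (exp_coord Y Q eps t) i))
      @ 0^' --> (0 : M).

(* Q' = L Q is the equation given by the system at first order in eps. *)
Definition is_linearization (G : set M) (V : ('I_n -> M) -> 'I_n -> M)
    (Y : 'I_n -> M) (L : ('I_n -> M) -> 'I_n -> M) : Prop :=
  forall (Q : R -> 'I_n -> M) (t : R) (Q' : 'I_n -> M),
    (forall s, lie_algebra_n G (Q s)) ->
    (forall i, mderiv (Q ^~ i) t (Q' i)) ->
    first_order_solution V Y Q t <-> (forall i, Q' i = L (Q t) i).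

Definition linear_operator (E F : set ('I_n -> M))
    (L : ('I_n -> M) -> 'I_n -> M) : Prop :=
  (forall Q, E Q -> F (L Q)) /\
  (forall (c : R) (Q P : 'I_n -> M), E Q -> E P -> forall i,
    L (fun j => c%:S *: Q j + P j) i = c%:S *: L Q i + L P i).

(* Partial sums of the series over p in L_{Y,ij} W.  The powers surrounding W
   are those of Y_i^-1 A^-1 B Y_j and of its inverse Y_j^-1 B^-1 A Y_i: with
   Z = B Y_j Y_i^-1 A^-1,
     Y_i^-1 Z^q B Y_j    = Y_i^-1 B Y_j (Y_i^-1 A^-1 B Y_j)^q,
     Y_i^-1 A^-1 Z^r Y_i = (Y_i^-1 A^-1 B Y_j)^r Y_i^-1 A^-1 Y_i,
   and similarly for Z^-1 = A Y_i Y_j^-1 B^-1.  The powers of Z and Z^-1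
   themselves would be wrong here for noncommuting matrices. *)
Definition LYij_series (a : nat -> R) (A B : M) (Y : 'I_n -> M)
    (i j : 'I_n) (W : M) : nat -> M :=
  fun N : nat => \sum_(1 <= p < N) (a p)%:S *:
    (((Y i)^-1 * B * Y j)
       * (\sum_(0 <= q < p) ((Y i)^-1 * A^-1 * B * Y j) ^+ q * W
                            * ((Y i)^-1 * A^-1 * B * Y j) ^+ (p - q - 1))
       * ((Y i)^-1 * A^-1 * Y i)
     + ((Y i)^-1 * A * Y i)
       * (\sum_(0 <= q < p) ((Y j)^-1 * B^-1 * A * Y i) ^+ q * W
                            * ((Y j)^-1 * B^-1 * A * Y i) ^+ (p - q - 1))
       * ((Y j)^-1 * B^-1 * Y i)).

Definition LYij (a : nat -> R) (A B : M) (Y : 'I_n -> M) (i j : 'I_n)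
    (W : M) : M :=
  (2^-1)%:S *: limn (LYij_series a A B Y i j W).

Definition LY (gamma : 'I_n -> 'I_n -> R) (a : nat -> R) (A B : M)
    (Y : 'I_n -> M) (Q : 'I_n -> M) (i : 'I_n) : M :=
  \sum_j (gamma i j)%:S *: LYij a A B Y i j (Q j - Q i).

End LoheModel.

(* Main.v *)
Require Import Defs.
From HB Require Import structures.
From mathcomp Require Import all_boot all_order all_algebra complex.
From mathcomp Require Import all_classical all_reals all_analysis.
From mathcomp Require Import zify ring lra.
Import numFieldNormedType.Exports.
Import Order.TTheory GRing.Theory Num.Theory.

(** The key device is the divided difference of the power series f,
  ddiff a U V H = sum_p a_p sum_(q < p) U^q H V^(p-q-1),
which satisfies f(U) - f(V) = ddiff a U V (U - V) exactly, for noncommuting U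
and V (exprB_noncomm, f_mx_sub).  Dividing a difference of f along a
curve by the parameter and letting U, V tend to Z shows that the derivative of
f at Z in the direction H is ddiff a Z Z H, as soon as ddiff is jointly
continuous (cvg_ddiff).  With Z = B Y_j Y_i^-1 A^-1 = x y, where x = B Y_j and
y = Y_i^-1 A^-1, the curve obtained from X_i = Y_i exp(eps Q_i) leaves Z in the
direction x (Q_j - Q_i) y; moving x and y across the powers of Z and of Z^-1
turns the derivative of g into Y_i L_{Y,ij}(Q_j - Q_i) Y_i^-1
(LYij_seriesE, LYij_series_cvg, mderiv_g_mx).  Since V(Y) = 0 at a fixed point,
V(X)/eps tends to Y_i (L_Y Q)_i Y_i^-1, while X_i' X_i^-1 / eps tends to
Y_i Q_i' Y_i^-1; the two limits agree precisely when Q' = L_Y Q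
(first_order_solutionP).

Convergence and continuity of ddiff are the analytic heart.  They need bounds
|U^q| <= D s^q, uniform for U near Z, with an s such that sum_p |a_p| (p+1) s^p
is finite.  They come from the growth of |Z^p|: let r be the infimum of the s > 0 such
that |Z^m| < s^m for some m > 0 (the spectral radius, by Gelfand's formula).
Every s in this set bounds the powers near Z, by continuity of U |-> |U^m| and
submultiplicativity (power_bounded_near); every s below r satisfies
|Z^p| >= s^p for all p > 0, so convergence of the series at (1 + e) Z bounds
|a_p| ((1 + e) s)^p.  Choosing s close to r on both sides leaves a geometric
margin (analytic_majorized).

That L_Y takes values in the Lie algebra uses the Lohe property: Z^p - Z^-p
lies in the Lie algebra for Z in G, hence so does g(Z), the Lie algebra being a
closed real subspace (lie_algebra_g_mx); L_{Y,ij} W is, up to conjugation by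
Y_i and the factor 1/2, the derivative at 0 of g along the curve
B Y_j exp(h W) Y_i^-1 A^-1 of G (lie_algebra_LYij).  The subspace properties
all follow from the fact that the velocity at 1 of a curve c in G lies in the
Lie algebra, because c(t/n)^n tends to exp(t c'(0)) (pow_cvg_mexp,
lie_algebra_tangent). *)

Set Implicit Arguments.
Unset Strict Implicit.
Unset Printing Implicit Defensive.

Local Open Scope classical_set_scope.
Local Open Scope ring_scope.

Lemma cvg_dist0 (R : realType) {T : Type} {F : set_system T} {FF : Filter F}
    (u : T -> R) (l : R) :
  u @ F --> l -> `|u n - l| @[n --> F] --> 0.
Proof. by move=> ul; apply/norm_cvg0P/subr_cvg0. Qed.

(** * Real and complex scalars *)

Section Scalars.
Context {R : realType} {cplx : bool}.
Local Notation K := (scalars R cplx).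
Local Notation "x %:S" := (@of_real R cplx x) (at level 2, format "x %:S").

Lemma of_real_zmod_morphism : zmod_morphism (@of_real R cplx).
Proof. by rewrite /of_real; case: cplx => x y //=; rewrite rmorphB. Qed.

Lemma of_real_monoid_morphism : monoid_morphism (@of_real R cplx).
Proof. by rewrite /of_real; case: cplx; split=> // x y; rewrite rmorphM. Qed.

HB.instance Definition _ :=
  GRing.isZmodMorphism.Build R K (@of_real R cplx) of_real_zmod_morphism.
HB.instance Definition _ :=
  GRing.isMonoidMorphism.Build R K (@of_real R cplx) of_real_monoid_morphism.

Lemma of_real0 : 0%:S = 0. Proof. exact: rmorph0. Qed.
Lemma of_real1 : 1%:S = 1. Proof. exact: rmorph1. Qed.
Lemma of_realD x y : (x + y)%:S = x%:S + y%:S. Proof. exact: rmorphD. Qed.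
Lemma of_realN x : (- x)%:S = - x%:S. Proof. exact: rmorphN. Qed.
Lemma of_realM x y : (x * y)%:S = x%:S * y%:S. Proof. exact: rmorphM. Qed.
Lemma of_realV x : (x^-1)%:S = (x%:S)^-1. Proof. exact: fmorphV. Qed.
Lemma of_real_nat n : (n%:R)%:S = n%:R. Proof. exact: rmorph_nat. Qed.
Lemma of_realX x n : (x ^+ n)%:S = x%:S ^+ n. Proof. exact: rmorphXn. Qed.

Lemma ler_of_real x y : (x%:S <= y%:S) = (x <= y).
Proof. by rewrite /of_real; case: cplx => //=; rewrite lecR. Qed.

Lemma ltr_of_real x y : (x%:S < y%:S) = (x < y).
Proof. by rewrite /of_real; case: cplx => //=; rewrite ltcR. Qed.

(** The norm of [scalars R cplx] takes its values in the field itself; its real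
    value is needed to compare it with real series. *)
Definition modulus : K -> R :=
  if cplx return scalars R cplx -> R then (fun x : R[i] => complex.Re `|x|)
  else Num.norm.

Lemma normr_modulus (x : K) : `|x| = (modulus x)%:S.
Proof.
by rewrite /modulus /of_real; move: x; case: cplx => // x; rewrite normc_def.
Qed.

Lemma modulus_ge0 x : 0 <= modulus x.
Proof. by rewrite -ler_of_real -normr_modulus of_real0. Qed.

Lemma of_real_inj : injective (@of_real R cplx).
Proof. by move=> x y e; apply/eqP; rewrite eq_le -!ler_of_real e lexx. Qed.

Lemma modulusD x y : modulus (x + y) <= modulus x + modulus y.
Proof. by rewrite -ler_of_real of_realD -!normr_modulus ler_normD. Qed.

Lemma modulusM x y : modulus (x * y) = modulus x * modulus y.
Proof. by apply: of_real_inj; rewrite of_realM -!normr_modulus normrM. Qed.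

Lemma modulusN x : modulus (- x) = modulus x.
Proof. by apply: of_real_inj; rewrite -!normr_modulus normrN. Qed.

Lemma modulus0 : modulus 0 = 0.
Proof. by apply: of_real_inj; rewrite -normr_modulus normr0 of_real0. Qed.

Lemma modulus1 : modulus 1 = 1.
Proof. by apply: of_real_inj; rewrite -normr_modulus normr1 of_real1. Qed.

Lemma modulus_of_real x : modulus x%:S = `|x|.
Proof.
rewrite /modulus /of_real; case: cplx => //=.
by rewrite expr0n /= addr0 sqrtr_sqr.
Qed.

Lemma bounded_normed_series_cvg (u : nat -> R) c :
  (forall n, \sum_(0 <= k < n) `|u k| <= c) -> cvgn (series u).
Proof.
move=> u_le; apply: normed_cvg; apply: nondecreasing_is_cvgn.
  by apply: nondecreasing_series => n _ _; exact: normr_ge0.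
by exists c => _ [n _ <-]; exact: u_le.
Qed.

(** Absolute convergence implies convergence over either field; for complex
    scalars the real and imaginary parts are dominated by the modulus. *)
Lemma scalars_series_cvg (u : nat -> K) c :
  (forall n, \sum_(0 <= k < n) modulus (u k) <= c) ->
  exists l, modulus (series u n - l) @[n --> \oo] --> 0.
Proof.
rewrite /modulus; move: u; case: cplx => u u_le; last first.
  have /cvg_ex[l ul] := bounded_normed_series_cvg u_le.
  by exists l; exact: cvg_dist0.
have normcE (z : R[i]) :
    complex.Re `|z| = Num.sqrt (complex.Re z ^+ 2 + complex.Im z ^+ 2).
  by rewrite normc_def.
have Re_le (z : R[i]) : `|complex.Re z| <= complex.Re `|z|.
  by rewrite normcE -sqrtr_sqr ler_wsqrtr // lerDl sqr_ge0.
have Im_le (z : R[i]) : `|complex.Im z| <= complex.Re `|z|.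
  by rewrite normcE -sqrtr_sqr ler_wsqrtr // lerDr sqr_ge0.
have normc_le (z : R[i]) :
    complex.Re `|z| <= `|complex.Re z| + `|complex.Im z|.
  rewrite normcE -[leRHS]ger0_norm ?addr_ge0 // -sqrtr_sqr ler_wsqrtr //.
  by rewrite sqrrD !real_normK ?num_real // -addrA lerD2l lerDr
    mulrn_wge0 ?mulr_ge0.
have /cvg_ex[x ux] : cvgn (series (fun k => complex.Re (u k))).
  apply: (@bounded_normed_series_cvg _ c) => n.
  by apply: le_trans (u_le n); apply: ler_sum => k _; exact: Re_le.
have /cvg_ex[y uy] : cvgn (series (fun k => complex.Im (u k))).
  apply: (@bounded_normed_series_cvg _ c) => n.
  by apply: le_trans (u_le n); apply: ler_sum => k _; exact: Im_le.
exists (x +i* y)%C.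
apply: (@squeeze_cvgr _ _ _ _ (fun=> 0) (fun n =>
  `|series (fun k => complex.Re (u k)) n - x|
  + `|series (fun k => complex.Im (u k)) n - y|)).
- apply: nearW => n; rewrite normcE sqrtr_ge0 -normcE /=.
  apply: le_trans (normc_le _) _.
  by rewrite !raddfB /= /series /= !raddf_sum.
- exact: cvg_cst.
- rewrite -[X in _ --> X](addr0 0); apply: cvgD;
    by exact: cvg_dist0.
Qed.
End Scalars.

(** * A real submultiplicative matrix norm *)

Section MatrixNorm.
Context {R : realType} {cplx : bool} {d : nat}.
Local Notation K := (scalars R cplx).
Local Notation M := ('M[K]_d.+1).
Local Notation "x %:S" := (@of_real R cplx x) (at level 2, format "x %:S").
Implicit Types (Z W : M).

(** The operator norm attached to the supremum norm of vectors: it is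
    submultiplicative with [nrm 1 = 1], so powers are bounded by powers of the
    norm without constants. *)
Definition nrm Z : R := \big[Num.max/0]_i \sum_j modulus (Z i j).

Lemma row_le_nrm Z i : \sum_j modulus (Z i j) <= nrm Z.
Proof. exact: (le_bigmax 0 (fun i => \sum_j modulus (Z i j))). Qed.

Lemma nrm_ge0 Z : 0 <= nrm Z.
Proof. exact: bigmax_ge_id. Qed.

Lemma nrm_le Z c : 0 <= c -> (forall i, \sum_j modulus (Z i j) <= c) ->
  nrm Z <= c.
Proof. by move=> c0 Zc; apply/bigmax_leP. Qed.

Lemma modulus_le_nrm Z i j : modulus (Z i j) <= nrm Z.
Proof.
apply: le_trans (row_le_nrm Z i); rewrite (bigD1 j) //= lerDl.
by apply: sumr_ge0 => k _; exact: modulus_ge0.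
Qed.

Lemma nrm0 : nrm 0 = 0.
Proof.
apply/eqP; rewrite eq_le nrm_ge0 andbT; apply: nrm_le => // i.
by rewrite big1 // => j _; rewrite mxE modulus0.
Qed.

Lemma nrm1 : nrm 1 = 1.
Proof.
have row1 i : \sum_j modulus ((1 : M) i j) = 1.
  rewrite (bigD1 i) //= big1 ?mxE ?eqxx ?modulus1 ?addr0 // => j ji.
  by rewrite mxE eq_sym (negPf ji) modulus0.
apply/eqP; rewrite eq_le; apply/andP; split.
  by apply: nrm_le => // i; rewrite row1.
by rewrite -(row1 ord0) row_le_nrm.
Qed.

Lemma nrmD Z W : nrm (Z + W) <= nrm Z + nrm W.
Proof.
apply: nrm_le => [|i]; first by rewrite addr_ge0 ?nrm_ge0.
apply: le_trans (lerD (row_le_nrm Z i) (row_le_nrm W i)).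
by rewrite -big_split ler_sum // => j _; rewrite mxE modulusD.
Qed.

Lemma nrmN Z : nrm (- Z) = nrm Z.
Proof.
by apply: eq_bigr => i _; apply: eq_bigr => j _; rewrite mxE modulusN.
Qed.

Lemma nrmB Z W : nrm (Z - W) = nrm (W - Z).
Proof. by rewrite -nrmN opprB. Qed.

Lemma nrm_sum (I : Type) (s : seq I) (P : pred I) (F : I -> M) :
  nrm (\sum_(i <- s | P i) F i) <= \sum_(i <- s | P i) nrm (F i).
Proof.
elim/big_rec2: _ => [|i x y _ yx]; first by rewrite nrm0.
by apply: le_trans (nrmD _ _) _; rewrite lerD2l.
Qed.

Lemma modulus_sum (I : Type) (s : seq I) (F : I -> K) :
  modulus (\sum_(i <- s) F i) <= \sum_(i <- s) modulus (F i).
Proof.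
elim/big_rec2: _ => [|i x y _ yx]; first by rewrite modulus0.
by apply: le_trans (modulusD _ _) _; rewrite lerD2l.
Qed.

Lemma nrmM Z W : nrm (Z * W) <= nrm Z * nrm W.
Proof.
apply: nrm_le => [|i]; first by rewrite mulr_ge0 ?nrm_ge0.
apply: (@le_trans _ _ (\sum_k modulus (Z i k) * nrm W)); last first.
  by rewrite -mulr_suml ler_wpM2r ?nrm_ge0 ?row_le_nrm.
apply: (@le_trans _ _ (\sum_j \sum_k modulus (Z i k) * modulus (W k j))).
  apply: ler_sum => j _; rewrite mxE; apply: le_trans (modulus_sum _ _) _.
  by apply: ler_sum => k _; rewrite modulusM.
rewrite exchange_big; apply: ler_sum => k _.
by rewrite -mulr_sumr ler_wpM2l ?modulus_ge0 ?row_le_nrm.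
Qed.

Lemma nrmX Z n : nrm (Z ^+ n) <= nrm Z ^+ n.
Proof.
elim: n => [|n IHn]; first by rewrite !expr0 nrm1.
rewrite !exprS; apply: le_trans (nrmM _ _) _.
by rewrite ler_wpM2l ?nrm_ge0.
Qed.

Lemma nrm_scale_le (c : R) Z : nrm (c%:S *: Z) <= `|c| * nrm Z.
Proof.
apply: nrm_le => [|i]; first by rewrite mulr_ge0 ?nrm_ge0.
rewrite -(modulus_of_real (cplx := cplx)).
apply: le_trans (ler_wpM2l (modulus_ge0 _) (row_le_nrm Z i)).
by rewrite mulr_sumr ler_sum // => j _; rewrite mxE modulusM.
Qed.

Lemma nrm_scale (c : R) Z : nrm (c%:S *: Z) = `|c| * nrm Z.
Proof.
apply/eqP; rewrite eq_le nrm_scale_le /=.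
have [->|c0] := eqVneq c 0; first by rewrite normr0 mul0r nrm_ge0.
have := nrm_scale_le c^-1 (c%:S *: Z).
rewrite scalerA -of_realM mulVf // of_real1 scale1r normfV.
by rewrite -ler_pdivrMl ?invrK // invr_gt0 normr_gt0.
Qed.

Section Convergence.
Context {T : Type} {F : set_system T} {FF : Filter F}.

(** Reduces convergence of matrices over either field to convergence of a real
    function; the analysis that follows is carried out on real numbers. *)
Lemma cvg_nrmP (f : T -> M) (l : M) :
  f @ F --> l <-> nrm (f x - l) @[x --> F] --> 0.
Proof.
split=> [fl|fl].
  apply/cvgr0Pnorm_le => e e0.
  have e'0 : 0 < (e / d.+1%:R)%:S :> K.
    by rewrite -of_real0 ltr_of_real divr_gt0.
  have /cvg_ballP/(_ _ e'0) := fl; apply: filterS => x [_ fxl].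
  rewrite ger0_norm ?nrm_ge0 //; apply: nrm_le => [|i]; first exact: ltW.
  apply: (@le_trans _ _ (\sum_(j < d.+1) e / d.+1%:R)).
    apply: ler_sum => j _; rewrite -(ler_of_real (cplx := cplx)) -normr_modulus.
    have := fxl i j; rewrite -ball_normE /= => /ltW; rewrite distrC.
    by rewrite !mxE.
  by rewrite sumr_const card_ord -(mulr_natr (e / _)) divfK // pnatr_eq0.
apply/cvg_ballP => e e0.
have eE : e = (modulus e)%:S by rewrite -normr_modulus ger0_norm ?ltW.
have me0 : 0 < modulus e by rewrite -(ltr_of_real (cplx := cplx)) -eE of_real0.
have /cvgr0Pnorm_lt/(_ _ me0) := fl; apply: filterS => x fxl.
split=> // i j; rewrite -ball_normE /= distrC eE.
have -> : f x i j - l i j = (f x - l) i j by rewrite !mxE.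
rewrite normr_modulus ltr_of_real; apply: le_lt_trans (modulus_le_nrm _ _ _) _.
by apply: le_lt_trans fxl; exact: ler_norm.
Qed.

Lemma cvg_nrm_squeeze (f : T -> M) (l : M) (b : T -> R) :
  (\forall x \near F, nrm (f x - l) <= b x) -> b @ F --> 0 -> f @ F --> l.
Proof.
move=> fb b0; apply/cvg_nrmP; apply: (squeeze_cvgr _ (cvg_cst 0) b0).
by apply: filterS fb => x ->; rewrite nrm_ge0.
Qed.

Lemma near_nrm_lt (f : T -> M) (l : M) (e : R) : f @ F --> l -> 0 < e ->
  \forall x \near F, nrm (f x - l) < e.
Proof.
move=> /cvg_nrmP/cvgr0Pnorm_lt + e0 => /(_ _ e0); apply: filterS => x.
by apply: le_lt_trans; exact: ler_norm.
Qed.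

Lemma cvg_mx_mul (f g : T -> M) (a b : M) :
  f @ F --> a -> g @ F --> b -> (fun x => f x * g x) @ F --> a * b.
Proof.
move=> /cvg_nrmP fa /cvg_nrmP gb.
apply: (@cvg_nrm_squeeze _ _ (fun x => nrm (f x - a) * nrm (g x - b)
  + nrm (f x - a) * nrm b + nrm a * nrm (g x - b))).
  apply: nearW => x.
  have -> : f x * g x - a * b =
      (f x - a) * (g x - b) + (f x - a) * b + a * (g x - b).
    rewrite mulrBr mulrBl [a * (_ - _)]mulrBr mulrBl subrK.
    by rewrite addrA subrK.
  apply: le_trans (nrmD _ _) _; apply: lerD; last exact: nrmM.
  by apply: le_trans (nrmD _ _) _; apply: lerD; exact: nrmM.
have -> : 0 = 0 * 0 + 0 * nrm b + nrm a * 0 :> R.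
  by rewrite !mul0r mulr0 !addr0.
apply: cvgD; last by apply: cvgM => //; exact: cvg_cst.
by apply: cvgD; apply: cvgM => //; exact: cvg_cst.
Qed.

Lemma cvg_mx_scale (c : T -> R) (f : T -> M) (c0 : R) (a : M) :
  c @ F --> c0 -> f @ F --> a ->
  (fun x => (c x)%:S *: f x) @ F --> c0%:S *: a.
Proof.
move=> /cvg_dist0 cc /cvg_nrmP fa.
apply: (@cvg_nrm_squeeze _ _ (fun x => `|c x - c0| * nrm (f x - a)
  + `|c x - c0| * nrm a + `|c0| * nrm (f x - a))).
  apply: nearW => x.
  have -> : (c x)%:S *: f x - c0%:S *: a =
      (c x - c0)%:S *: (f x - a) + (c x - c0)%:S *: a + c0%:S *: (f x - a).
    by rewrite -scalerDr subrK of_realD of_realN scalerBl scalerBr addrA subrK.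
  apply: le_trans (nrmD _ _) _; apply: lerD; last exact: nrm_scale_le.
  by apply: le_trans (nrmD _ _) _; apply: lerD; exact: nrm_scale_le.
have -> : 0 = 0 * 0 + 0 * nrm a + `|c0| * 0 :> R.
  by rewrite !mul0r mulr0 !addr0.
apply: cvgD; last by apply: cvgM => //; exact: cvg_cst.
by apply: cvgD; apply: cvgM => //; exact: cvg_cst.
Qed.

Lemma cvg_mx_sum (I : Type) (s : seq I) (f : I -> T -> M) (l : I -> M) :
  (forall i, f i @ F --> l i) ->
  (fun x => \sum_(i <- s) f i x) @ F --> \sum_(i <- s) l i.
Proof.
move=> fl; elim: s => [|i s IHs].
  rewrite big_nil; under eq_fun do rewrite big_nil; exact: cvg_cst.
rewrite big_cons; under eq_fun do rewrite big_cons; exact: cvgD.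
Qed.

Lemma cvg_mx_exp (f : T -> M) (a : M) n :
  f @ F --> a -> (fun x => f x ^+ n) @ F --> a ^+ n.
Proof.
move=> fa; elim: n => [|n IHn].
  rewrite expr0; under eq_fun do rewrite expr0; exact: cvg_cst.
rewrite exprS; under eq_fun do rewrite exprS; exact: cvg_mx_mul.
Qed.

End Convergence.

(** Writes X^-1 - a^-1 as X^-1 (a - X) a^-1; once |X - a| |a^-1| <= 1/2 this
    identity first bounds X^-1 by 2 |a^-1| and then yields convergence. *)
Lemma cvg_mx_inv {T : Type} {F : set_system T} {FF : Filter F} (f : T -> M)
    (a : M) : (forall x, f x \is a GRing.unit) -> a \is a GRing.unit ->
  f @ F --> a -> (fun x => (f x)^-1) @ F --> a^-1.
Proof.
move=> uf ua fa.
apply: (cvg_nrm_squeeze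
    (b := fun x => 2 * nrm a^-1 ^+ 2 * nrm (f x - a))); last first.
  rewrite -[X in _ --> X](mulr0 (2 * nrm a^-1 ^+ 2)).
  by apply: cvgM; [exact: cvg_cst | apply/cvg_nrmP].
have e0 : 0 < (2 * (nrm a^-1 + 1))^-1.
  by rewrite invr_gt0 mulr_gt0 // ltr_wpDl ?nrm_ge0.
apply: filterS (near_nrm_lt fa e0) => x fxa.
have invB : (f x)^-1 - a^-1 = (f x)^-1 * (a - f x) * a^-1.
  by rewrite mulrBr mulrBl mulVr // mul1r -mulrA divrr // mulr1.
have le1 : nrm ((f x)^-1 - a^-1) <=
    nrm (f x)^-1 * nrm (f x - a) * nrm a^-1.
  rewrite invB; apply: le_trans (nrmM _ _) _.
  by rewrite ler_wpM2r ?nrm_ge0 // (nrmB (f x)) nrmM.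
have small : nrm (f x - a) * nrm a^-1 <= 2^-1.
  have h : 2^-1 = (2 * (nrm a^-1 + 1))^-1 * (nrm a^-1 + 1).
    by field; rewrite gt_eqF // ltr_wpDl ?nrm_ge0.
  by rewrite h; apply: ler_pM; rewrite ?nrm_ge0 // ?ltW // ltrDl.
have le2 : nrm (f x)^-1 <= 2 * nrm a^-1.
  have : nrm (f x)^-1 <= nrm a^-1 + nrm (f x)^-1 * 2^-1.
    rewrite -{1}[(f x)^-1](subrK a^-1) addrC; apply: le_trans (nrmD _ _) _.
    rewrite lerD2l; apply: le_trans le1 _; rewrite -mulrA.
    by rewrite ler_wpM2l ?nrm_ge0.
  lra.
apply: le_trans le1 _; rewrite expr2.
have -> : 2 * (nrm a^-1 * nrm a^-1) * nrm (f x - a) =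
  2 * nrm a^-1 * nrm (f x - a) * nrm a^-1 by ring.
by do 2![rewrite ler_wpM2r ?nrm_ge0 //].
Qed.

Lemma nrm_lim_le {T : Type} {F : set_system T} {FF : ProperFilter F}
    (f : T -> M) (l : M) c :
  f @ F --> l -> (\forall x \near F, nrm (f x) <= c) -> nrm l <= c.
Proof.
move=> fl fc; rewrite leNgt; apply/negP => lc.
have e0 : 0 < nrm l - c by rewrite subr_gt0.
have [x [fxc fxl]] := filter_ex (filterI fc (near_nrm_lt fl e0)).
move: fxl; rewrite ltNge => /negP; apply.
rewrite lerBlDr; have -> : l = f x - (f x - l) by rewrite subKr.
apply: le_trans (nrmD _ _) _; rewrite nrmN addrC subKr lerD2l; exact: fxc.
Qed.

End MatrixNorm.

(** * Dominated series of matrices *)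

Section DominatedSeries.
Context {R : realType} {cplx : bool} {d : nat}.
Local Notation K := (scalars R cplx).
Local Notation M := ('M[K]_d.+1).
Local Notation "x %:S" := (@of_real R cplx x) (at level 2, format "x %:S").

Lemma nrm_series_cvg (u : nat -> M) (c : R) :
  (forall n, \sum_(0 <= k < n) nrm (u k) <= c) -> cvgn (series u).
Proof.
move=> uc; have entry (ij : 'I_d.+1 * 'I_d.+1) : exists l : K,
    modulus (series (fun k => u k ij.1 ij.2) n - l) @[n --> \oo] --> 0.
  apply: (@scalars_series_cvg _ _ _ c) => n; apply: le_trans (uc n).
  by apply: ler_sum => k _; exact: modulus_le_nrm.
have [l ul] := choice entry.
apply/cvg_ex; exists (\matrix_(i, j) l (i, j)).
apply: (@cvg_nrm_squeeze _ _ _ _ _ _ _ _ (fun n => \sum_i \sum_j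
  modulus (series (fun k => u k i j) n - l (i, j)))).
  apply: nearW => n; apply: nrm_le => [|i].
    by do 2![apply: sumr_ge0 => ? _]; exact: modulus_ge0.
  rewrite [leRHS](bigD1 i) //= -[leLHS]addr0; apply: lerD.
    by apply: ler_sum => j _; rewrite /series /= !mxE summxE.
  by do 2![apply: sumr_ge0 => ? _]; exact: modulus_ge0.
have sum0 : \sum_(i < d.+1) \sum_(j < d.+1) 0 = 0 :> R.
  by rewrite big1 // => i _; rewrite big1.
rewrite -[X in _ --> X]sum0.
apply: cvg_big => [|i _]; first exact: add_continuous.
apply: cvg_big => [|j _]; first exact: add_continuous.
exact: (ul (i, j)).
Qed.

Lemma bounded_series_le_limn (b : nat -> R) (c : R) : (forall p, 0 <= b p) ->
  (forall n, \sum_(0 <= p < n) b p <= c) ->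
  cvgn (series b) /\ (forall n, series b n <= limn (series b)).
Proof.
move=> b0 bc; have ndb : nondecreasing_seq (series b).
  by apply: nondecreasing_series => n _ _; exact: b0.
have cb : cvgn (series b).
  by apply: nondecreasing_is_cvgn => //; exists c => _ [n _ <-]; exact: bc.
by split=> // n; exact: nondecreasing_cvgn_le.
Qed.

Lemma nrm_series_tail (u : nat -> M) (b : nat -> R) (c : R) n :
  (forall p, nrm (u p) <= b p) -> (forall n, series b n <= c) ->
  nrm (limn (series u) - series u n) <= c - series b n.
Proof.
move=> ub bc.
have cu : cvgn (series u).
  apply: (@nrm_series_cvg _ c) => m; apply: le_trans (bc m).
  by apply: ler_sum => k _; exact: ub.
apply: (@nrm_lim_le _ _ _ _ \oo _ (fun m => series u m - series u n)).
  by apply: cvgB cu _; exact: cvg_cst.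
exists n => // m /= nm; rewrite sub_series_geq //.
apply: le_trans (nrm_sum _ _ _) _.
apply: (@le_trans _ _ (\sum_(n <= k < m) b k)).
  by apply: ler_sum => k _; exact: ub.
by rewrite lerBrDr -sub_series_geq // subrK.
Qed.

(** Dominated convergence for series (Tannery): the tails are small uniformly
    in x, and the finitely many remaining terms converge one by one. *)
Lemma cvg_series_dominated {T : Type} {F : set_system T} {FF : ProperFilter F}
    (u : T -> nat -> M) (l : nat -> M) (b : nat -> R) (c : R) :
  (forall p, u x p @[x --> F] --> l p) ->
  (\forall x \near F, forall p, nrm (u x p) <= b p) ->
  (forall n, \sum_(0 <= p < n) b p <= c) ->
  limn (series (u x)) @[x --> F] --> limn (series l).
Proof.
move=> ul ub bc.
have b0 p : 0 <= b p.
  by have [x ubx] := filter_ex ub; apply: le_trans (ubx p); exact: nrm_ge0.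
have lb p : nrm (l p) <= b p.
  by apply: (nrm_lim_le (ul p)); apply: filterS ub => x.
have [cb leb] := bounded_series_le_limn b0 bc.
apply/cvg_nrmP/cvgr0Pnorm_le => e e0.
have e3 : 0 < e / 3 by rewrite divr_gt0.
have /cvgrPdist_le/(_ _ e3)[n _ /(_ n (leqnn n)) /=] :
  series b @ \oo --> limn (series b) by exact: cb.
rewrite ger0_norm ?subr_ge0 // => tail.
have un : series (u x) n @[x --> F] --> series l n.
  exact: (cvg_mx_sum _ (f := fun p x => u x p)).
apply: filterS2 ub (near_nrm_lt un e3) => x ubx uxn.
rewrite ger0_norm ?nrm_ge0 //.
have -> : limn (series (u x)) - limn (series l) =
    (limn (series (u x)) - series (u x) n) + (series (u x) n - series l n)
    - (limn (series l) - series l n).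
  by rewrite opprB !subrKA.
apply: le_trans (nrmD _ _) _; rewrite nrmN.
have -> : e = e / 3 + e / 3 + e / 3 by field.
apply: lerD; last exact: le_trans (nrm_series_tail n lb leb) tail.
apply: le_trans (nrmD _ _) _; apply: lerD; last exact: ltW.
exact: le_trans (nrm_series_tail n ubx leb) tail.
Qed.

End DominatedSeries.

(** * Divided differences of power series *)

Section DividedDifference.
Context {R : realType} {cplx : bool} {d : nat}.
Local Notation K := (scalars R cplx).
Local Notation M := ('M[K]_d.+1).
Local Notation "x %:S" := (@of_real R cplx x) (at level 2, format "x %:S").
Implicit Types (a : nat -> R) (s D : R) (U V Z H : M).

(** The [p]-th term of the divided difference of the power series; it is 0 for
    [p = 0], so the sum may start at 0 although that of f starts at 1. *)
Definition ddiff_term a U V H (p : nat) : M :=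
  (a p)%:S *: \sum_(0 <= q < p) U ^+ q * H * V ^+ (p - q - 1).

Definition ddiff a U V H : M := limn (series (ddiff_term a U V H)).

Definition power_bounded s D U : Prop := forall q, nrm (U ^+ q) <= D * s ^+ q.

(** The factor [p.+1] dominates both the coefficients of f and those of its
    derivative, so that one hypothesis serves both series. *)
Definition weight_summable a s : Prop :=
  exists c, forall n, \sum_(0 <= p < n) `|a p| * (p.+1%:R * s ^+ p) <= c.

(** The form in which analyticity at [Z] is used: one dominating series for f
    and its divided differences, valid on a whole neighbourhood of [Z]. *)
Definition majorized_at a Z : Prop :=
  exists s D, [/\ 0 < s, weight_summable a s &
    \forall U \near Z, power_bounded s D U].

Lemma power_bounded_ge0 s D U : power_bounded s D U -> 0 <= D.
Proof.
by move=> /(_ 0%N); rewrite !expr0 nrm1 mulr1; apply: le_trans; exact: ler01.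
Qed.

Lemma ddiff_term_le a s D U V H p : 0 < s ->
  power_bounded s D U -> power_bounded s D V ->
  nrm (ddiff_term a U V H p) <=
    D ^+ 2 * nrm H / s * (`|a p| * (p.+1%:R * s ^+ p)).
Proof.
move=> s0 bU bV; have D0 := power_bounded_ge0 bU.
have [->|p0] := posnP p.
  rewrite /ddiff_term big_geq // scaler0 nrm0.
  by rewrite !mulr_ge0 ?invr_ge0 ?exprn_ge0 ?nrm_ge0 // ltW.
apply: le_trans (nrm_scale_le _ _) _; rewrite mulrCA ler_wpM2l //.
apply: le_trans (nrm_sum _ _ _) _.
apply: (@le_trans _ _ (\sum_(0 <= q < p) D ^+ 2 * nrm H / s * s ^+ p)).
  rewrite !big_mkord; apply: ler_sum => q _.
  apply: le_trans (nrmM _ _) _.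
  apply: (@le_trans _ _ (D * s ^+ q * nrm H * (D * s ^+ (p - q - 1)))).
    apply: ler_pM; rewrite ?nrm_ge0 ?bV //.
    apply: le_trans (nrmM _ _) _.
    by rewrite ler_wpM2r ?nrm_ge0 ?bU.
  have -> : s ^+ p = s ^+ q * s ^+ (p - q - 1) * s.
    by rewrite -exprD -exprSr; congr (s ^+ _); have := ltn_ord q; lia.
  rewrite le_eqVlt; apply/orP; left; apply/eqP.
  by field; rewrite gt_eqF.
rewrite sumr_const_nat subn0 -mulrnAr -(mulr_natl (s ^+ p)) ler_wpM2l //.
  by rewrite !mulr_ge0 ?invr_ge0 ?exprn_ge0 ?nrm_ge0 // ltW.
by rewrite ler_wpM2r ?exprn_ge0 ?ler_nat // ltW.
Qed.

Lemma sum_weight_le a s (C : R) : 0 <= C -> weight_summable a s ->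
  exists c, forall n,
    \sum_(0 <= p < n) C * (`|a p| * (p.+1%:R * s ^+ p)) <= c.
Proof.
move=> C0 [c ac]; exists (C * c) => n.
by rewrite -mulr_sumr ler_wpM2l.
Qed.

Lemma ddiff_cvg a s D U V H : 0 < s -> weight_summable a s ->
  power_bounded s D U -> power_bounded s D V ->
  cvgn (series (ddiff_term a U V H)).
Proof.
move=> s0 sa bU bV; have D0 := power_bounded_ge0 bU.
have C0 : 0 <= D ^+ 2 * nrm H / s.
  by rewrite !mulr_ge0 ?invr_ge0 ?exprn_ge0 ?nrm_ge0 // ltW.
have [c ac] := sum_weight_le C0 sa.
apply: (@nrm_series_cvg _ _ _ _ c) => n; apply: le_trans (ac n).
by apply: ler_sum => p _; exact: ddiff_term_le.
Qed.

Lemma ddiffZ (a : nat -> R) s (D0 : R) (U V H : M) (c : R) : 0 < s ->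
  weight_summable a s -> power_bounded s D0 U -> power_bounded s D0 V ->
  ddiff a U V (c%:S *: H) = c%:S *: ddiff a U V H.
Proof.
move=> s0 sa bU bV; rewrite /ddiff.
apply: cvg_lim => //.
rewrite (_ : series _ = fun n => c%:S *: series (ddiff_term a U V H) n).
  by apply: cvg_mx_scale; [exact: cvg_cst | exact: ddiff_cvg bU bV].
apply/funext => n; rewrite /series /= scaler_sumr; apply: eq_bigr => p _.
rewrite /ddiff_term !scaler_sumr; apply: eq_bigr => q _.
by rewrite -scalerAr -scalerAl !scalerA mulrC.
Qed.

Lemma ddiffD (a : nat -> R) s (D0 : R) (U V H H' : M) : 0 < s ->
  weight_summable a s -> power_bounded s D0 U -> power_bounded s D0 V ->
  ddiff a U V (H + H') = ddiff a U V H + ddiff a U V H'.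
Proof.
move=> s0 sa bU bV; rewrite /ddiff.
apply: cvg_lim => //.
rewrite (_ : series _ = fun n =>
    series (ddiff_term a U V H) n + series (ddiff_term a U V H') n).
  by apply: cvgD; exact: ddiff_cvg bU bV.
apply/funext => n; rewrite /series /= -big_split; apply: eq_bigr => p _ /=.
rewrite /ddiff_term -scalerDr -big_split; congr (_ *: _); apply: eq_bigr => q _.
by rewrite mulrDr mulrDl.
Qed.

Lemma pseries_cvg a s D U : 0 < s -> weight_summable a s ->
  power_bounded s D U -> cvgn (series (fun p => (a p)%:S *: U ^+ p)).
Proof.
move=> s0 sa bU; have D0 := power_bounded_ge0 bU.
have [c ac] := sum_weight_le D0 sa.
apply: (@nrm_series_cvg _ _ _ _ c) => n; apply: le_trans (ac n).
apply: ler_sum => p _; apply: le_trans (nrm_scale_le _ _) _.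
rewrite mulrCA ler_wpM2l //; apply: le_trans (bU p) _.
rewrite ler_wpM2l // ler_peMl ?ler1n //.
by rewrite exprn_ge0 // ltW.
Qed.

Lemma pseries_mxE a U n :
  pseries_mx a U n.+1 = series (fun p => (a p)%:S *: U ^+ p) n.+1 - (a 0)%:S%:A.
Proof. by rewrite /series /= [in RHS]big_ltn // expr0 addrC addKr. Qed.

Lemma pseries_mx_cvg a s D U : 0 < s -> weight_summable a s ->
  power_bounded s D U ->
  pseries_mx a U @ \oo -->
    limn (series (fun p => (a p)%:S *: U ^+ p)) - (a 0)%:S%:A.
Proof.
move=> s0 sa bU; have cf := pseries_cvg s0 sa bU.
rewrite -cvg_shiftS; under eq_fun do rewrite pseries_mxE.
apply: cvgB; last exact: cvg_cst.
by rewrite (cvg_shiftS (series _)).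
Qed.

Lemma majorized_self (a : nat -> R) Z : majorized_at a Z ->
  exists s D, [/\ 0 < s, weight_summable a s & power_bounded s D Z].
Proof.
by move=> [s [D [s0 sa bD]]]; exists s, D; split=> //; exact: nbhs_singleton bD.
Qed.

Lemma f_mx_cvg (a : nat -> R) Z :
  majorized_at a Z -> pseries_mx a Z @ \oo --> f_mx a Z.
Proof.
move=> /majorized_self[s [D [s0 sa bD]]].
by have /cvgP := pseries_mx_cvg s0 sa bD.
Qed.

(** The sum telescopes because all powers of [U] stay on the left and all powers
    of [V] on the right. *)
Lemma exprB_noncomm U V p :
  U ^+ p - V ^+ p = \sum_(0 <= q < p) U ^+ q * (U - V) * V ^+ (p - q - 1).
Proof.
elim: p => [|p IHp]; first by rewrite big_geq // !expr0 subrr.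
rewrite big_ltn // expr0 mul1r subn0 subn1 /=.
have -> : \sum_(1 <= q < p.+1) U ^+ q * (U - V) * V ^+ (p.+1 - q - 1) =
    U * (U ^+ p - V ^+ p).
  rewrite IHp mulr_sumr big_add1 /=; apply: eq_bigr => q _.
  by rewrite exprS subSS !mulrA.
by rewrite !exprS mulrBl mulrBr [RHS]addrC subrKA.
Qed.

Lemma f_mx_sub a s D U V : 0 < s -> weight_summable a s ->
  power_bounded s D U -> power_bounded s D V ->
  f_mx a U - f_mx a V = ddiff a U V (U - V).
Proof.
move=> s0 sa bU bV; rewrite /f_mx (cvg_lim _ (pseries_mx_cvg s0 sa bU)) //.
rewrite (cvg_lim _ (pseries_mx_cvg s0 sa bV)) // opprB addrA subrK.
rewrite -limB; [|exact: pseries_cvg bU|exact: pseries_cvg bV].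
congr (limn _); apply/funext => n /=; rewrite fctE /series /= -sumrB.
apply: eq_bigr => p _; by rewrite /ddiff_term -exprB_noncomm scalerBr.
Qed.

(** Continuity of the divided difference on the diagonal, which is what makes
    [ddiff a Z Z] the derivative of the power series at [Z]. *)
Lemma cvg_ddiff a Z H0 {T : Type} {F : set_system T} {FF : ProperFilter F}
    (U V H : T -> M) :
  majorized_at a Z -> U @ F --> Z -> V @ F --> Z -> H @ F --> H0 ->
  ddiff a (U x) (V x) (H x) @[x --> F] --> ddiff a Z Z H0.
Proof.
move=> [s [D [s0 sa bZ]]] UZ VZ HH0.
have D0 : 0 <= D := power_bounded_ge0 (nbhs_singleton bZ).
have C0 : 0 <= D ^+ 2 * (nrm H0 + 1) / s.
  by rewrite !mulr_ge0 ?invr_ge0 ?exprn_ge0 ?addr_ge0 ?nrm_ge0 // ltW.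
have [c ac] := sum_weight_le C0 sa.
apply: (cvg_series_dominated _ _ ac) => [p|].
  apply: cvg_mx_scale; first exact: cvg_cst.
  apply: (cvg_mx_sum _ (f := fun q x => U x ^+ q * H x * V x ^+ (p - q - 1))).
  move=> q; apply: cvg_mx_mul; last exact: cvg_mx_exp.
  by apply: cvg_mx_mul => //; exact: cvg_mx_exp.
have bU : \forall x \near F, power_bounded s D (U x) by exact: UZ bZ.
have bV : \forall x \near F, power_bounded s D (V x) by exact: VZ bZ.
apply: filterS3 bU bV (near_nrm_lt HH0 ltr01) => x {}bU {}bV Hx p.
apply: le_trans (ddiff_term_le _ _ _ s0 bU bV) _.
rewrite ler_wpM2r ?mulr_ge0 ?exprn_ge0 //; first exact: ltW.
rewrite ler_wpM2r ?invr_ge0 ?(ltW s0) // ler_wpM2l ?exprn_ge0 //.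
rewrite -[H x](subrK H0) addrC; apply: le_trans (nrmD _ _) _.
by rewrite lerD2l ltW.
Qed.

End DividedDifference.

(** * Bounds on powers near a point of convergence *)

Section Majorization.
Context {R : realType} {cplx : bool} {d : nat}.
Local Notation K := (scalars R cplx).
Local Notation M := ('M[K]_d.+1).
Local Notation "x %:S" := (@of_real R cplx x) (at level 2, format "x %:S").
Implicit Types (a : nat -> R) (s D : R) (U V Z H : M).

(** The terms are at most C (p+1) (s/r)^p, and sum_p (p+1) t^p is bounded by
    1/(1-t)^2 for 0 <= t < 1. *)
Lemma weight_summable_geometric a s r (C : R) : 0 < s -> s < r ->
  (forall p, `|a p| * r ^+ p <= C) -> weight_summable a s.
Proof.
move=> s0 sr aC; have r0 : 0 < r := lt_trans s0 sr.
pose t := s / r.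
have t0 : 0 <= t by rewrite divr_ge0 // ltW.
have t1 : 0 < 1 - t by rewrite subr_gt0 ltr_pdivrMr ?mul1r.
have C0 : 0 <= C by apply: le_trans (aC 0%N); rewrite expr0 mulr1.
have sum_t n : (1 - t) ^+ 2 * \sum_(0 <= p < n) p.+1%:R * t ^+ p =
    1 - (1 + n%:R * (1 - t)) * t ^+ n.
  elim: n => [|n IHn]; first by rewrite big_geq // mulr0 mul0r addr0 mul1r subrr.
  rewrite big_nat_recr //= mulrDr IHn (exprS t) -natr1.
  ring.
exists (C * ((1 - t) ^+ 2)^-1) => n.
apply: (@le_trans _ _ (C * \sum_(0 <= p < n) p.+1%:R * t ^+ p)).
  rewrite mulr_sumr; apply: ler_sum => p _.
  have -> : s = t * r by rewrite divfK // gt_eqF.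
  rewrite exprMn mulrCA [in leRHS]mulrCA ler_wpM2l //.
  rewrite mulrCA mulrC ler_wpM2r ?exprn_ge0 //.
rewrite ler_wpM2l // -[leRHS]mul1r ler_pdivlMr ?exprn_gt0 //.
rewrite mulrC sum_t gerBl mulr_ge0 ?exprn_ge0 // addr_ge0 // mulr_ge0 //.
exact: ltW.
Qed.

(** A single strict inequality |Z^m| < s^m persists near [Z] and controls all
    powers, by Euclidean division of the exponent by [m]. *)
Lemma power_bounded_near Z s m : 0 < s -> (0 < m)%N -> nrm (Z ^+ m) < s ^+ m ->
  exists D, \forall U \near Z, power_bounded s D U.
Proof.
move=> s0 m0 Zm.
(* t s bounds |U| near Z, and t >= 1 allows t^(q mod m) <= t^m. *)
pose t := Num.max 1 ((nrm Z + 1) / s).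
have t1 : 1 <= t by rewrite le_max lexx.
have t0 : 0 <= t := le_trans ler01 t1.
exists (t ^+ m).
have idZ : id @ nbhs Z --> Z by exact: cvg_id.
have e0 : 0 < s ^+ m - nrm (Z ^+ m) by rewrite subr_gt0.
have nearZ : \forall U \near Z, nrm (U - Z) < 1 by exact: near_nrm_lt idZ ltr01.
have cvgZm : (fun U : M => U ^+ m) @ nbhs Z --> Z ^+ m.
  exact: (cvg_mx_exp idZ).
have nearZm : \forall U \near Z,
    nrm (U ^+ m - Z ^+ m) < s ^+ m - nrm (Z ^+ m).
  exact: near_nrm_lt cvgZm e0.
apply: filterS2 nearZ nearZm => U UZ UZm q.
have Um : nrm (U ^+ m) <= s ^+ m.
  rewrite -[U ^+ m](subrK (Z ^+ m)); apply: le_trans (nrmD _ _) _.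
  by rewrite -lerBrDr ltW.
have Us : nrm U <= t * s.
  apply: (@le_trans _ _ (nrm Z + 1)).
    rewrite -[U](subrK Z); apply: le_trans (nrmD _ _) _.
    by rewrite addrC lerD2l ltW.
  by rewrite -ler_pdivrMr // le_max lexx orbT.
rewrite {1 2}(divn_eq q m) mulnC !exprD !exprM.
apply: le_trans (nrmM _ _) _; rewrite mulrCA; apply: ler_pM; rewrite ?nrm_ge0 //.
  apply: le_trans (nrmX _ _) _.
  by rewrite lerXn2r ?nnegrE ?nrm_ge0 ?exprn_ge0 // ltW.
apply: le_trans (nrmX _ _) _.
apply: (@le_trans _ _ ((t * s) ^+ (q %% m))).
  by rewrite lerXn2r ?nnegrE ?nrm_ge0 ?mulr_ge0 // ltW.
rewrite exprMn ler_wpM2r ?exprn_ge0 ?(ltW s0) // ler_weXn2l //.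
by rewrite ltnW // ltn_mod.
Qed.

Lemma series_terms_bounded a U : cvgn (pseries_mx a U) ->
  exists C, forall p, (0 < p)%N -> `|a p| * nrm (U ^+ p) <= C.
Proof.
move=> cU; set l := limn (pseries_mx a U).
have /cvg_nrmP nl : pseries_mx a U @ \oo --> l by exact: cU.
have [B nB] : exists B, forall n, nrm (pseries_mx a U n - l) <= B.
  have [B [_ Bb]] := cvg_seq_bounded (cvgP _ nl).
  exists (B + 1) => n; rewrite -[leLHS]ger0_norm ?nrm_ge0 //.
  by apply: Bb => //; rewrite ltrDl.
exists (B + B) => p p0; rewrite -nrm_scale.
have -> : (a p)%:S *: U ^+ p =
    (pseries_mx a U p.+1 - l) - (pseries_mx a U p - l).
  by rewrite /pseries_mx big_nat_recr //= opprB subrKA addrAC subrr add0r.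
by apply: le_trans (nrmD _ _) _; rewrite nrmN lerD.
Qed.

(** Compares the growth of |Z^p| from above and from below with the infimum of
    the rates s such that |Z^m| < s^m for some m > 0; convergence at (1 + e) Z
    provides the margin between the two.  Invertibility of [Z] makes that
    infimum positive. *)
Lemma analytic_majorized a Z : Z \is a GRing.unit ->
  (\forall W \near Z, cvgn (pseries_mx a W)) -> majorized_at a Z.
Proof.
move=> uZ aZ.
have [e [e0 ce]] : exists e, 0 < e /\ cvgn (pseries_mx a ((1 + e)%:S *: Z)).
  have cvgZ : (1 + e)%:S *: Z @[e --> 0^'+] --> Z.
    rewrite -[X in _ --> X]scale1r -of_real1 -[1 in X in _ --> X]addr0.
    apply: cvg_mx_scale; last exact: cvg_cst.
    by apply: cvgD; [exact: cvg_cst | apply: cvg_at_right_filter; exact: cvg_id].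
  have near_cvg : \forall e \near (0 : R)^'+,
      cvgn (pseries_mx a ((1 + e)%:S *: Z)) by exact: cvgZ aZ.
  have [e [e0 ce]] := filter_ex (filterI (nbhs_right_gt (0 : R)) near_cvg).
  by exists e.
have [C aC] := series_terms_bounded ce.
(* The infimum of S is the spectral radius of Z, by Gelfand's formula. *)
pose S := [set s : R | 0 < s /\ exists2 m, (0 < m)%N & nrm (Z ^+ m) < s ^+ m].
have invZ : 1 <= nrm Z * nrm Z^-1.
  by rewrite -(@nrm1 R cplx d) -(divrr uZ); exact: nrmM.
have Zi0 : 0 < nrm Z^-1.
  rewrite lt_neqAle nrm_ge0 andbT eq_sym; apply: contraTneq invZ => ->.
  by rewrite mulr0 -ltNge ltr01.
have S_ge s : S s -> (nrm Z^-1)^-1 <= s.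
  move=> [s0 [m m0 Zm]]; rewrite leNgt; apply/negP => sZ.
  have : (s * nrm Z^-1) ^+ m < 1.
    by rewrite exprn_ilt1 -?lt0n ?mulr_ge0 ?nrm_ge0 ?(ltW s0) //
      -ltr_pdivlMr // mul1r.
  apply/negP; rewrite -leNgt -(@nrm1 R cplx d) -(divrr (unitrX m uZ)).
  apply: le_trans (nrmM _ _) _; rewrite exprMn -exprVn.
  by apply: ler_pM; rewrite ?nrm_ge0 ?nrmX // ltW.
have infS : has_inf S.
  split; last by exists (nrm Z^-1)^-1 => s /S_ge.
  exists (nrm Z + 1); split; first by rewrite ltr_wpDl ?nrm_ge0.
  by exists 1%N => //; rewrite !expr1 ltrDl.
pose r := inf S.
have r0 : 0 < r.
  apply: (@lt_le_trans _ _ (nrm Z^-1)^-1); first by rewrite invr_gt0.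
  by apply: lb_le_inf infS.1 _ => s /S_ge.
have re0 : 0 < r * (e / 2) by rewrite mulr_gt0 ?divr_gt0.
have [s [s0 [m m0 Zm]] sr] := inf_adherent re0 infS.
have [D bD] := power_bounded_near s0 m0 Zm.
exists s, D; split=> //.
(* s is in S and below r', while r' / (1 + e) is below r, so not in S. *)
pose r' := r * (1 + e / 2).
have sr' : s < r' by rewrite /r' mulrDr mulr1.
have r'0 : 0 < r' := lt_trans s0 sr'.
have e1 : 0 < 1 + e by rewrite addr_gt0.
pose s1 := r' / (1 + e).
have s1r : s1 < r.
  by rewrite ltr_pdivrMr // ltr_pM2l // ltrD2l ltr_pdivrMr // ltr_pMr // ltr1n.
have s1Z p : (0 < p)%N -> s1 ^+ p <= nrm (Z ^+ p).
  move=> p0; rewrite leNgt; apply/negP => Zp.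
  have : S s1 by split; [rewrite divr_gt0 | exists p].
  by move/(ge_inf infS.2); rewrite leNgt s1r.
apply: (@weight_summable_geometric _ _ r' (Num.max `|a 0%N| C) s0 sr') => p.
have [->|p0] := posnP p; first by rewrite expr0 mulr1 le_max lexx.
rewrite le_max; apply/orP; right; apply: le_trans (aC p p0).
have -> : ((1 + e)%:S *: Z) ^+ p = ((1 + e) ^+ p)%:S *: Z ^+ p.
  by rewrite exprZn of_realX.
rewrite ler_wpM2l // (@nrm_scale R cplx d) ger0_norm ?exprn_ge0 ?(ltW e1) //.
have -> : r' = (1 + e) * s1 by rewrite mulrC divfK // gt_eqF.
by rewrite exprMn ler_wpM2l ?exprn_ge0 ?s1Z // ltW.
Qed.

End Majorization.

(** * The exponential series *)

Section Exponential.
Context {R : realType} {cplx : bool} {d : nat}.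
Local Notation K := (scalars R cplx).
Local Notation M := ('M[K]_d.+1).
Local Notation "x %:S" := (@of_real R cplx x) (at level 2, format "x %:S").
Implicit Types (U V Z H : M).

(** The coefficients of exp; the constant term is dropped by [f_mx] and restored
    in [mexpE]. *)
Definition exp_weight (k : nat) : R := (k`!%:R)^-1.

Lemma weight_summable_exp s : 0 < s -> weight_summable exp_weight s.
Proof.
move=> s0; have s20 : 0 <= s * 2 by rewrite mulr_ge0 // ltW.
apply: (@weight_summable_geometric _ _ _ (s * 2) (expR (s * 2))) => //.
  by rewrite ltr_pMr // ltr1n.
move=> [|p]; rewrite ger0_norm ?invr_ge0 // mulrC.
  by rewrite expr0 mul1r /exp_weight fact0 invr1 -[leLHS]expR0 ler_expR.
by apply: le_trans (expR_ge1Dxn p s20); rewrite lerDr.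
Qed.

Lemma majorized_exp Z : majorized_at exp_weight Z.
Proof.
have s0 : 0 < nrm Z + 1 by rewrite ltr_wpDl ?nrm_ge0.
have Zs : nrm (Z ^+ 1) < (nrm Z + 1) ^+ 1 by rewrite !expr1 ltrDl.
have [D bD] := power_bounded_near s0 (ltn0Sn 0) Zs.
by exists (nrm Z + 1), D; split=> //; exact: weight_summable_exp.
Qed.

Lemma mexpE Z : mexp Z = 1 + f_mx exp_weight Z.
Proof.
have [s [D [s0 sa bD]]] := majorized_self (majorized_exp Z).
rewrite /f_mx (cvg_lim _ (pseries_mx_cvg s0 sa bD)) //.
rewrite {2}/exp_weight fact0 invr1 of_real1 scale1r addrC subrK.
congr (limn _); apply/funext => n; apply: eq_bigr => k _.
by rewrite /exp_weight of_realV of_real_nat.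
Qed.

Lemma mexp_series_cvg Z :
  series (fun k => (exp_weight k)%:S *: Z ^+ k) @ \oo --> mexp Z.
Proof.
have [s [D [s0 sa bD]]] := majorized_self (majorized_exp Z).
have seriesE : (fun N => \sum_(0 <= k < N) (k`!%:R)^-1 *: Z ^+ k) =
    series (fun k => (exp_weight k)%:S *: Z ^+ k).
  apply/funext => n; apply: eq_bigr => k _.
  by rewrite /exp_weight of_realV of_real_nat.
by rewrite /mexp seriesE; exact: (pseries_cvg s0 sa bD).
Qed.

Lemma mexp0 : mexp (0 : M) = 1.
Proof.
apply: lim_near_cst => //; exists 1%N => // -[//|n] _ /=.
rewrite big_nat_recl // expr0 fact0 invr1 scale1r big1 ?addr0 // => k _.
by rewrite expr0n scaler0.
Qed.

Lemma cvg_mexp {T : Type} {F : set_system T} {FF : ProperFilter F}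
    (f : T -> M) (Z : M) : f @ F --> Z -> mexp (f x) @[x --> F] --> mexp Z.
Proof.
move=> fZ; have [s [D [s0 sa bZ]]] := majorized_exp Z.
have bf : \forall x \near F, power_bounded s D (f x) by exact: fZ bZ.
apply/subr_cvg0.
have dd0 : ddiff exp_weight Z Z 0 = 0 :> M.
  have := ddiffZ 0 0 s0 sa (nbhs_singleton bZ) (nbhs_singleton bZ).
  by rewrite !of_real0 !scale0r.
rewrite -dd0.
apply: (@cvg_trans _ (ddiff exp_weight (f x) Z (f x - Z) @[x --> F])); last first.
  apply: cvg_ddiff => //; [exact: majorized_exp | exact: cvg_cst |].
  exact/subr_cvg0.
apply: near_eq_cvg; apply: filterS bf => x bx.
rewrite -(f_mx_sub s0 sa bx (nbhs_singleton bZ)) !mexpE opprD addrACA subrr.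
by rewrite add0r.
Qed.

Lemma ddiff_exp00 H : ddiff exp_weight 0 0 H = H.
Proof.
apply: lim_near_cst => //; exists 2%N => // -[//|[//|n]] _ /=.
rewrite /series /= big_nat_recl // big_nat_recl //.
rewrite big1 ?addr0 => [|p _].
  rewrite /ddiff_term big_geq // scaler0 add0r big_nat1 !expr0 mul1r mulr1.
  by rewrite /exp_weight factS fact0 muln1 invr1 of_real1 scale1r.
rewrite /ddiff_term big1_seq ?scaler0 // => q.
rewrite mem_index_iota => /andP[_ /andP[_ qp]].
case: q qp => [|q] qp; last by rewrite expr0n !mul0r.
by rewrite subn0 subn1 /= exprS mul0r mulr0.
Qed.

End Exponential.

(** * Derivatives of matrix curves *)

Section Derivative.
Context {R : realType} {cplx : bool} {d : nat}.
Local Notation K := (scalars R cplx).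
Local Notation M := ('M[K]_d.+1).
Local Notation "x %:S" := (@of_real R cplx x) (at level 2, format "x %:S").
Implicit Types (X W : R -> M) (t : R) (D E : M).

Lemma mderiv_unique X t D E : mderiv X t D -> mderiv X t E -> D = E.
Proof. exact: cvg_unique. Qed.

Lemma mderiv_cvg X t D : mderiv X t D -> X (t + h) @[h --> 0^'] --> X t.
Proof.
move=> XD.
have -> : (fun h => X (t + h)) =
    (fun h => h%:S *: ((h^-1)%:S *: (X (t + h) - X t)) + X t).
  apply/funext => h; have [->|h0] := eqVneq h 0.
    by rewrite of_real0 scale0r addr0 add0r.
  by rewrite scalerA -of_realM divff // of_real1 scale1r subrK.
rewrite -[X in _ --> X]add0r; apply: cvgD; last exact: cvg_cst.
rewrite -[X in _ --> X](scale0r D) -of_real0; apply: cvg_mx_scale => //.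
exact: cvg_within.
Qed.

Lemma mderiv_cst (D : M) t : mderiv (fun=> D) t 0.
Proof.
rewrite /mderiv; under eq_fun do rewrite subrr scaler0; exact: cvg_cst.
Qed.

Lemma mderiv_id (D : M) t : mderiv (fun h => h%:S *: D) t D.
Proof.
apply: cvg_near_cst; near=> h.
have h0 : h != 0 by near: h; exact: (nbhs_dnbhs_neq (0 : R)).
rewrite -scalerBl -of_realN -of_realD addrC addKr scalerA -of_realM mulVf //.
by rewrite of_real1 scale1r.
Unshelve. all: by end_near. Qed.

Lemma mderivD X W t D E : mderiv X t D -> mderiv W t E ->
  mderiv (fun s => X s + W s) t (D + E).
Proof.
move=> XD WE; rewrite /mderiv.
under eq_fun do rewrite opprD addrACA scalerDr.
exact: cvgD.
Qed.

Lemma mderivZ (c : R) X t D : mderiv X t D ->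
  mderiv (fun s => c%:S *: X s) t (c%:S *: D).
Proof.
move=> XD; rewrite /mderiv.
under eq_fun do rewrite -scalerBr scalerA -of_realM mulrC of_realM -scalerA.
by apply: cvg_mx_scale => //; exact: cvg_cst.
Qed.

Lemma mderivN X t D : mderiv X t D -> mderiv (fun s => - X s) t (- D).
Proof.
move=> XD; rewrite /mderiv.
under eq_fun do rewrite -opprD scalerN.
exact: cvgN.
Qed.

Lemma mderiv_sum (I : Type) (r : seq I) (X : I -> R -> M) t (D : I -> M) :
  (forall i, mderiv (X i) t (D i)) ->
  mderiv (fun s => \sum_(i <- r) X i s) t (\sum_(i <- r) D i).
Proof.
move=> XD; elim: r => [|i r IHr].
  by rewrite big_nil; under eq_fun do rewrite big_nil; exact: mderiv_cst.
rewrite big_cons; under eq_fun do rewrite big_cons.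
exact: (mderivD (XD i) IHr).
Qed.

Lemma mderivM X W t D E : mderiv X t D -> mderiv W t E ->
  mderiv (fun s => X s * W s) t (D * W t + X t * E).
Proof.
move=> XD WE; rewrite /mderiv.
have -> : (fun h => (h^-1)%:S *: (X (t + h) * W (t + h) - X t * W t)) =
    (fun h => ((h^-1)%:S *: (X (t + h) - X t)) * W (t + h)
      + X t * ((h^-1)%:S *: (W (t + h) - W t))).
  apply/funext => h; rewrite -scalerAl -scalerAr -scalerDr mulrBl mulrBr.
  by rewrite subrKA.
apply: cvgD; apply: cvg_mx_mul => //; last exact: cvg_cst.
exact: mderiv_cvg WE.
Qed.

Lemma mderivV X t D : (forall s, X s \is a GRing.unit) -> mderiv X t D ->
  mderiv (fun s => (X s)^-1) t (- ((X t)^-1 * D * (X t)^-1)).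
Proof.
move=> uX XD; rewrite /mderiv.
have -> : (fun h => (h^-1)%:S *: ((X (t + h))^-1 - (X t)^-1)) =
    (fun h => - ((X (t + h))^-1 * ((h^-1)%:S *: (X (t + h) - X t)) * (X t)^-1)).
  apply/funext => h; rewrite -scalerAr -scalerAl -scalerN; congr (_ *: _).
  rewrite mulrBr mulrBl mulVr // mul1r -mulrA divrr // mulr1.
  by rewrite opprB.
apply: cvgN; apply: cvg_mx_mul; last exact: cvg_cst.
apply: cvg_mx_mul => //; apply: cvg_mx_inv => //; exact: mderiv_cvg XD.
Qed.

(** The difference quotient of f along [X] is a divided difference applied to
    the difference quotient of [X]; let the parameter tend to 0. *)
Lemma mderiv_f_mx (a : nat -> R) X t D : majorized_at a (X t) ->
  mderiv X t D -> mderiv (fun s => f_mx a (X s)) t (ddiff a (X t) (X t) D).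
Proof.
move=> aX XD; have cX := mderiv_cvg XD.
have [s [D0 [s0 sa bX]]] := aX.
have bXt := nbhs_singleton bX.
have bXh : \forall h \near 0^', power_bounded s D0 (X (t + h)) by exact: cX bX.
apply: (@cvg_trans _ (ddiff a (X (t + h)) (X t)
    ((h^-1)%:S *: (X (t + h) - X t)) @[h --> 0^'])); last first.
  by apply: cvg_ddiff => //; exact: cvg_cst.
apply: near_eq_cvg; apply: filterS bXh => h bh.
by rewrite (f_mx_sub s0 sa bh bXt) (ddiffZ _ _ s0 sa bh bXt).
Qed.

Lemma mderiv_mexp X t D : mderiv X t D ->
  mderiv (fun s => mexp (X s)) t (ddiff exp_weight (X t) (X t) D).
Proof.
move=> XD; rewrite (_ : (fun s => mexp (X s)) =
  fun s => 1 + f_mx exp_weight (X s)); last by apply/funext => s; exact: mexpE.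
rewrite -[ddiff _ _ _ _]add0r; apply: mderivD; first exact: mderiv_cst.
by apply: mderiv_f_mx => //; exact: majorized_exp.
Qed.

Lemma mderiv_mexp_scale (Q : M) : mderiv (fun h => mexp (h%:S *: Q)) 0 Q.
Proof.
have := mderiv_mexp (@mderiv_id Q 0).
by rewrite of_real0 scale0r ddiff_exp00.
Qed.

End Derivative.

(** * The exponential as a limit of powers *)

Section ExponentialLimit.
Context {R : realType} {cplx : bool} {d : nat}.
Local Notation K := (scalars R cplx).
Local Notation M := ('M[K]_d.+1).
Local Notation "x %:S" := (@of_real R cplx x) (at level 2, format "x %:S").
Implicit Types (X Z : M).

Lemma ffact_le_expn n k : (n ^_ k <= n ^ k)%N.
Proof.
rewrite ffact_prod -[k in (_ <= n ^ k)%N]card_ord -prod_nat_const.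
by apply: leq_prod => i _; exact: leq_subr.
Qed.

Lemma binomial_le_exp_weight n k :
  'C(n.+1, k)%:R / n.+1%:R ^+ k <= exp_weight k :> R.
Proof.
rewrite /exp_weight ler_pdivrMr ?exprn_gt0 // mulrC ler_pdivlMr ?ltr0n ?fact_gt0 //.
by rewrite -natrM -natrX ler_nat bin_ffact ffact_le_expn.
Qed.

Lemma bernoulli_ineq (y : R) n : 0 <= y <= 1 -> 1 - n%:R * y <= (1 - y) ^+ n.
Proof.
move=> /andP[y0 y1]; elim: n => [|n IHn]; first by rewrite mul0r subr0.
rewrite exprS; apply: (@le_trans _ _ ((1 - y) * (1 - n%:R * y))).
  rewrite -natr1; have : 0 <= n%:R * y ^+ 2 by rewrite mulr_ge0 ?exprn_ge0.
  by rewrite expr2; lra.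
by rewrite ler_wpM2l // subr_ge0.
Qed.

(** With y = x/n, the inequality e^-y >= 1 - y gives 1 + y >= e^y (1 - y^2);
    raise it to the power n and apply Bernoulli's inequality. *)
Lemma expR_sub_pow_le (x : R) n : 0 <= x ->
  expR x - (1 + x / n.+1%:R) ^+ n.+1 <= expR x * (x ^+ 2 / n.+1%:R).
Proof.
move=> x0; set y := x / n.+1%:R.
have y0 : 0 <= y by rewrite divr_ge0.
have n0 : n.+1%:R != 0 :> R by rewrite pnatr_eq0.
have -> : x ^+ 2 / n.+1%:R = n.+1%:R * y ^+ 2 by rewrite /y; field.
(* For y > 1 the right-hand side is already at least e^x. *)
have [y1|y1] := leP y 1; last first.
  have h : 1 <= n.+1%:R * y ^+ 2.
    by rewrite mulr_ege1 ?ler1n // exprn_ege1 // ltW.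
  apply: (@le_trans _ _ (expR x)).
    by rewrite gerBl exprn_ge0 // addr_ge0.
  by rewrite ler_peMr ?expR_ge0.
have ge1 : expR y * (1 - y ^+ 2) <= 1 + y.
  have /(ler_wpM2l (expR_ge0 y)) := expR_ge1Dx (- y).
  rewrite -expRD subrr expR0 => /(ler_wpM2r (_ : 0 <= 1 + y)).
  rewrite mul1r => /(_ (addr_ge0 ler01 y0)); apply: le_trans.
  by rewrite le_eqVlt; apply/orP; left; apply/eqP; ring.
have y2 : 0 <= y ^+ 2 <= 1 by rewrite exprn_ge0 ?exprn_ile1.
rewrite lerBlDr -lerBlDl -[X in X - _]mulr1 -mulrBr.
apply: (@le_trans _ _ ((expR y * (1 - y ^+ 2)) ^+ n.+1)).
  rewrite [leRHS]exprMn -expRM_natl (_ : n.+1%:R * y = x);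
    last by rewrite /y; field.
  by rewrite ler_wpM2l ?expR_ge0 ?bernoulli_ineq.
have [/andP[_ y21]] := y2.
by rewrite lerXn2r ?nnegrE ?addr_ge0 // mulr_ge0 ?expR_ge0 ?subr_ge0.
Qed.

Lemma pow_expand X n N : (n.+1 < N)%N ->
  (1 + (n.+1%:R^-1)%:S *: X) ^+ n.+1 =
  \sum_(0 <= k < N) ('C(n.+1, k)%:R / n.+1%:R ^+ k)%:S *: X ^+ k.
Proof.
move=> nN; rewrite addrC exprD1n big_mkord.
rewrite (big_ord_widen N (fun k => ((n.+1%:R^-1)%:S *: X) ^+ k *+ 'C(n.+1, k))) //.
rewrite [RHS](bigID (fun k : 'I_N => (k < n.+2)%N)) /= [X in _ + X]big1 ?addr0.
  apply: eq_bigr => k _; rewrite [(_ *: X) ^+ k]exprZn of_realM of_real_nat.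
  by rewrite -scalerA scaler_nat -of_realX exprVn.
move=> k; rewrite -leqNgt => nk; rewrite bin_small // mul0r of_real0.
by rewrite scale0r.
Qed.

Lemma pow_expand_real (x : R) n N : (n.+1 < N)%N ->
  (1 + x / n.+1%:R) ^+ n.+1 =
  \sum_(0 <= k < N) 'C(n.+1, k)%:R / n.+1%:R ^+ k * x ^+ k.
Proof.
move=> nN; rewrite addrC exprD1n big_mkord.
rewrite (big_ord_widen N (fun k => (x / n.+1%:R) ^+ k *+ 'C(n.+1, k))) //.
rewrite [RHS](bigID (fun k : 'I_N => (k < n.+2)%N)) /= [X in _ + X]big1 ?addr0.
  apply: eq_bigr => k _; rewrite exprMn exprVn -mulr_natl.
  by rewrite -[RHS]mulrA; congr (_ * _); rewrite mulrC.
by move=> k; rewrite -leqNgt => nk; rewrite bin_small // !mul0r.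
Qed.

(** The coefficients of exp(X) - (1 + X/n)^n are all nonnegative, so this norm
    is at most the same expression evaluated at the real number |X|. *)
Lemma mexp_sub_pow_le X n :
  nrm (mexp X - (1 + (n.+1%:R^-1)%:S *: X) ^+ n.+1) <=
    expR (nrm X) * (nrm X ^+ 2 / n.+1%:R).
Proof.
set x := nrm X; have x0 : 0 <= x := nrm_ge0 X.
apply: le_trans (expR_sub_pow_le n x0).
pose c k : R := exp_weight k - 'C(n.+1, k)%:R / n.+1%:R ^+ k.
apply: (@nrm_lim_le _ _ _ _ \oo _ (fun N =>
    series (fun k => (exp_weight k)%:S *: X ^+ k) N
    - (1 + (n.+1%:R^-1)%:S *: X) ^+ n.+1)).
  by apply: cvgB; [exact: mexp_series_cvg | exact: cvg_cst].
exists n.+2 => // N /= nN.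
rewrite (pow_expand X nN) /series /= -sumrB.
apply: le_trans (nrm_sum _ _ _) _.
apply: (@le_trans _ _ (\sum_(0 <= k < N) c k * x ^+ k)).
  apply: ler_sum => k _; rewrite -scalerBl -of_realN -of_realD nrm_scale.
  rewrite ger0_norm ?subr_ge0 ?binomial_le_exp_weight //.
  by rewrite ler_wpM2l ?nrmX // subr_ge0 binomial_le_exp_weight.
have -> : \sum_(0 <= k < N) c k * x ^+ k =
    series (exp_coeff x) N - (1 + x / n.+1%:R) ^+ n.+1.
  rewrite (pow_expand_real x nN) /series /= -sumrB; apply: eq_bigr => k _.
  by rewrite mulrBl; congr (_ - _); rewrite mulrC.
rewrite lerD2r; apply: nondecreasing_cvgn_le; last exact: is_cvg_series_exp_coeff.
by apply: nondecreasing_series => k _ _; exact: exp_coeff_ge0.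
Qed.

(** Telescoping U^n - (1 + X/n)^n costs a factor n and bounded powers, which is
    compensated by n |U - 1 - X/n| tending to 0. *)
Lemma pow_cvg_mexp (U : nat -> M) X :
  (n.+1%:R : R)%:S *: (U n - 1) @[n --> \oo] --> X ->
  U n ^+ n.+1 @[n --> \oo] --> mexp X.
Proof.
move=> UX; pose V n : M := 1 + (n.+1%:R^-1)%:S *: X.
pose B := expR (nrm X + 1).
have B0 : 0 <= B := expR_ge0 _.
pose b n := B * B * nrm ((n.+1%:R : R)%:S *: (U n - 1) - X)
  + expR (nrm X) * (nrm X ^+ 2 / n.+1%:R).
apply: (@cvg_nrm_squeeze _ _ _ _ _ _ _ _ b); last first.
  rewrite -[X in _ --> X]addr0 -[X in _ --> X + _](mulr0 (B * B)).
  apply: cvgD; first by apply: cvgM; [exact: cvg_cst | apply/cvg_nrmP].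
  rewrite -[X in _ --> X](mulr0 (expR (nrm X))); apply: cvgM; first exact: cvg_cst.
  rewrite -[X in _ --> X](mulr0 (nrm X ^+ 2)); apply: cvgM; first exact: cvg_cst.
  exact: cvg_harmonic.
apply: filterS (near_nrm_lt UX ltr01) => n Un.
rewrite -[U n ^+ n.+1](subrK (V n ^+ n.+1)) -addrA.
apply: le_trans (nrmD _ _) _; apply: lerD; last first.
  by rewrite nrmB; exact: mexp_sub_pow_le.
have n0 : (n.+1%:R : R) != 0 by rewrite pnatr_eq0.
(* U and V = 1 + X/n have norm at most 1 + (|X|+1)/n <= exp((|X|+1)/n). *)
have pow_le (W : M) q : nrm ((n.+1%:R : R)%:S *: (W - 1)) <= nrm X + 1 ->
    (q <= n.+1)%N -> nrm (W ^+ q) <= B.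
  move=> WX qn; apply: le_trans (nrmX _ _) _.
  have W1 : nrm W <= 1 + (nrm X + 1) / n.+1%:R.
    rewrite -{1}[W](subrK 1) addrC; apply: le_trans (nrmD _ _) _.
    rewrite nrm1 lerD2l ler_pdivlMr ?ltr0n // mulrC.
    by move: WX; rewrite nrm_scale ger0_norm.
  have X1 : 0 <= nrm X + 1 by rewrite addr_ge0 ?nrm_ge0.
  have s1 : 1 <= 1 + (nrm X + 1) / n.+1%:R by rewrite lerDl divr_ge0.
  apply: (@le_trans _ _ ((1 + (nrm X + 1) / n.+1%:R) ^+ n.+1)).
    apply: (@le_trans _ _ ((1 + (nrm X + 1) / n.+1%:R) ^+ q)).
      by rewrite lerXn2r ?nnegrE ?nrm_ge0 // (le_trans ler01).
    by rewrite ler_weXn2l.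
  have -> : B = expR ((nrm X + 1) / n.+1%:R) ^+ n.+1.
    by rewrite -expRM_natl /B; congr expR; field.
  by rewrite lerXn2r ?nnegrE ?expR_ge0 ?expR_ge1Dx // (le_trans ler01).
have UB q : (q <= n.+1)%N -> nrm (U n ^+ q) <= B.
  apply: pow_le; rewrite -[_ *: _](subrK X) addrC.
  by apply: le_trans (nrmD _ _) _; rewrite lerD2l ltW.
have VB q : (q <= n.+1)%N -> nrm (V n ^+ q) <= B.
  apply: pow_le; rewrite /V addrC addKr scalerA -of_realM divff //.
  by rewrite of_real1 scale1r lerDl.
rewrite exprB_noncomm; apply: le_trans (nrm_sum _ _ _) _.
apply: (@le_trans _ _ (\sum_(0 <= q < n.+1) B * B * nrm (U n - V n))).
  rewrite !big_mkord; apply: ler_sum => q _.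
  apply: le_trans (nrmM _ _) _; rewrite -mulrA [B * nrm _]mulrC mulrA.
  apply: ler_pM; rewrite ?nrm_ge0 //; last by apply: VB; lia.
  apply: le_trans (nrmM _ _) _; rewrite ler_wpM2r ?nrm_ge0 //.
  by apply: UB; rewrite ltnW.
rewrite sumr_const_nat subn0 -mulrnAr ler_wpM2l ?mulr_ge0 //.
have -> : (n.+1%:R : R)%:S *: (U n - 1) - X = (n.+1%:R : R)%:S *: (U n - V n).
  rewrite /V opprD addrA [in RHS]scalerBr scalerA -of_realM divff //.
  by rewrite of_real1 scale1r.
by rewrite nrm_scale ger0_norm // mulr_natl.
Qed.

(** The powers ((1 + X/n) (1 - X/n))^n = (1 - X^2/n^2)^n tend to exp(0) = 1 on
    one side and to exp(X) exp(-X) on the other. *)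
Lemma mexpN_mul X : mexp X * mexp (- X) = 1.
Proof.
pose V n : M := 1 + (n.+1%:R^-1)%:S *: X.
pose W n : M := 1 + (n.+1%:R^-1)%:S *: (- X).
have scaleK n (Z : M) : (n.+1%:R : R)%:S *: ((n.+1%:R^-1)%:S *: Z) = Z.
  by rewrite scalerA -of_realM divff ?pnatr_eq0 // of_real1 scale1r.
have powV Z : (1 + (n.+1%:R^-1)%:S *: Z) ^+ n.+1 @[n --> \oo] --> mexp Z.
  apply: pow_cvg_mexp; under eq_fun do rewrite addrC addKr scaleK.
  exact: cvg_cst.
have VW n : V n * W n = 1 + (n.+1%:R^-1)%:S *: ((n.+1%:R^-1)%:S *: - X ^+ 2).
  rewrite /V /W mulrDl mul1r mulrDr mulr1 -scalerAr -scalerAl mulrN -expr2.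
  by rewrite !scalerN -addrA addKr.
have comm_VW n : GRing.comm (V n) (W n).
  rewrite /GRing.comm VW /V /W mulrDl mul1r mulrDr mulr1 -scalerAr -scalerAl.
  by rewrite mulNr -expr2 !scalerN addrA addrK.
have to0 : (V n * W n) ^+ n.+1 @[n --> \oo] --> mexp 0.
  apply: pow_cvg_mexp.
  have -> : (fun n => (n.+1%:R : R)%:S *: (V n * W n - 1)) =
      (fun n => (n.+1%:R^-1)%:S *: - X ^+ 2).
    by apply/funext => n; rewrite VW addrC addKr scaleK.
  rewrite -[X in _ --> X](scale0r (- X ^+ 2)) -of_real0.
  by apply: cvg_mx_scale; [exact: cvg_harmonic | exact: cvg_cst].
have toXX : (V n * W n) ^+ n.+1 @[n --> \oo] --> mexp X * mexp (- X).
  under eq_fun do rewrite exprMn_comm //.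
  by apply: cvg_mx_mul; exact: powV.
by rewrite -mexp0; exact: cvg_unique toXX to0.
Qed.

Lemma mexp_unit X : mexp X \is a GRing.unit.
Proof.
apply/unitrP; exists (mexp (- X)); split; last exact: mexpN_mul.
by rewrite -{2}[X]opprK mexpN_mul.
Qed.

End ExponentialLimit.

(** * The Lie algebra of a matrix Lie group *)

Section LieAlgebra.
Context {R : realType} {cplx : bool} {d : nat}.
Local Notation K := (scalars R cplx).
Local Notation M := ('M[K]_d.+1).
Local Notation "x %:S" := (@of_real R cplx x) (at level 2, format "x %:S").
Variables (G : set M) (hG : matrix_lie_group G).
Implicit Types (P Q Z : M).

Lemma mlg_exp Z n : G Z -> G (Z ^+ n).
Proof.
move=> GZ; elim: n => [|n IHn]; first exact: mlg_one hG.
by rewrite exprS; exact: mlg_mul.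
Qed.

(** G is closed only in the general linear group, hence the hypothesis that the
    limit is invertible. *)
Lemma mlg_lim {T : Type} {F : set_system T} {FF : ProperFilter F} (f : T -> M)
    (Z : M) : (forall x, G (f x)) -> f @ F --> Z -> Z \is a GRing.unit -> G Z.
Proof.
move=> Gf fZ uZ; apply: mlg_closed => // B BZ.
have fB : \forall x \near F, B (f x) by exact: fZ BZ.
by have [x Bx] := filter_ex fB; exists (f x).
Qed.

Lemma lie_algebra_scale (c : R) Q :
  lie_algebra G Q -> lie_algebra G (c%:S *: Q).
Proof. by move=> GQ t; rewrite scalerA -of_realM; exact: GQ. Qed.

Lemma lie_algebra_lim {T : Type} {F : set_system T} {FF : ProperFilter F}
    (f : T -> M) Q :
  (forall x, lie_algebra G (f x)) -> f @ F --> Q -> lie_algebra G Q.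
Proof.
move=> Gf fQ t; apply: (@mlg_lim _ F _ _ _ (fun x => Gf x t)); last exact: mexp_unit.
by apply: cvg_mexp; apply: cvg_mx_scale => //; exact: cvg_cst.
Qed.

(** The powers c(t/n)^n stay in G and tend to exp(tQ), which is invertible. *)
Lemma lie_algebra_tangent (c : R -> M) Q :
  (forall h, G (c h)) -> c 0 = 1 -> mderiv c 0 Q -> lie_algebra G Q.
Proof.
move=> Gc c1 cQ t.
have [->|t0] := eqVneq t 0.
  by rewrite of_real0 scale0r mexp0; exact: mlg_one hG.
apply: (@mlg_lim _ \oo _ (fun n => c (t / n.+1%:R) ^+ n.+1)).
- by move=> n; exact: mlg_exp.
- apply: pow_cvg_mexp.
  (* As t is nonzero, the steps t/n avoid 0, which 0^' excludes. *)
  have to0 : t / n.+1%:R @[n --> \oo] --> 0^'.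
    move=> A; rewrite /dnbhs /within /= => A0.
    have t_to0 : t / n.+1%:R @[n --> \oo] --> 0.
      rewrite -[X in _ --> X](mulr0 t); apply: cvgM; first exact: cvg_cst.
      exact: cvg_harmonic.
    have : \forall n \near \oo, t / n.+1%:R != 0 -> A (t / n.+1%:R).
      exact: t_to0 A0.
    apply: (@filterS _ \oo) => n; apply.
    by rewrite mulf_neq0 // invr_eq0 pnatr_eq0.
  have := cvg_comp _ _ to0 cQ => cQn.
  have -> : (fun n => (n.+1%:R : R)%:S *: (c (t / n.+1%:R) - 1)) =
      (fun n => t%:S *: (((t / n.+1%:R)^-1)%:S *:
         (c (0 + t / n.+1%:R) - c 0))).
    apply/funext => n; rewrite c1 add0r scalerA -of_realM; congr (_ %:S *: _).
    by rewrite invf_div mulrCA divff // mulr1.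
  by apply: cvg_mx_scale; [exact: cvg_cst | exact: cQn].
- exact: mexp_unit.
Qed.

Lemma lie_algebra0 : lie_algebra G 0.
Proof. by move=> t; rewrite scaler0 mexp0; exact: mlg_one hG. Qed.

Lemma lie_algebraD P Q :
  lie_algebra G P -> lie_algebra G Q -> lie_algebra G (P + Q).
Proof.
move=> GP GQ.
apply: (@lie_algebra_tangent (fun h => mexp (h%:S *: P) * mexp (h%:S *: Q))).
- by move=> h; apply: mlg_mul.
- by rewrite of_real0 !scale0r mexp0 mulr1.
- have := mderivM (@mderiv_mexp_scale R cplx d P) (@mderiv_mexp_scale R cplx d Q).
  by rewrite of_real0 !scale0r mexp0 mulr1 mul1r.
Qed.

Lemma lie_algebraN Q : lie_algebra G Q -> lie_algebra G (- Q).
Proof.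
by move=> GQ; rewrite -scaleN1r -of_real1 -of_realN; exact: lie_algebra_scale.
Qed.

Lemma lie_algebra_sum (I : Type) (r : seq I) (F : I -> M) :
  (forall i, lie_algebra G (F i)) -> lie_algebra G (\sum_(i <- r) F i).
Proof.
move=> GF; apply: big_ind => //; [exact: lie_algebra0 | exact: lie_algebraD].
Qed.

Lemma lie_algebra_conj Z Q : G Z -> lie_algebra G Q ->
  lie_algebra G (Z^-1 * Q * Z).
Proof.
move=> GZ GQ.
apply: (@lie_algebra_tangent (fun h => Z^-1 * mexp (h%:S *: Q) * Z)).
- by move=> h; do 2![apply: mlg_mul => //]; exact: mlg_inv.
- by rewrite of_real0 scale0r mexp0 mulr1 mulVr //; exact: mlg_unit GZ.
- have := mderivM (mderivM (@mderiv_cst R cplx d Z^-1 0) (@mderiv_mexp_scale R cplx d Q))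
    (@mderiv_cst R cplx d Z 0).
  by rewrite mul0r add0r mulr0 addr0.
Qed.

Lemma lie_algebra_mderiv (X : R -> M) t D :
  (forall s, lie_algebra G (X s)) -> mderiv X t D -> lie_algebra G D.
Proof.
move=> GX; apply: lie_algebra_lim => h; apply: lie_algebra_scale.
by apply: lie_algebraD => //; exact: lie_algebraN.
Qed.

Lemma majorized_in_group (a : nat -> R) Z :
  analytic_on a G -> G Z -> majorized_at a Z.
Proof.
by move=> aG GZ; apply: analytic_majorized; [exact: mlg_unit GZ | exact: aG].
Qed.

(** Termwise, Z^p - Z^-p lies in the Lie algebra by the Lohe property applied
    to the element Z^p of G. *)
Lemma lie_algebra_g_mx (a : nat -> R) Z : lohe_closed G -> analytic_on a G ->
  G Z -> lie_algebra G (g_mx a Z).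
Proof.
move=> hLohe aG GZ; have GZi := mlg_inv hG GZ.
apply: (@lie_algebra_lim _ \oo _
    (fun n => pseries_mx a Z n - pseries_mx a Z^-1 n)).
  move=> n; rewrite /pseries_mx -sumrB; apply: lie_algebra_sum => p.
  rewrite -scalerBr exprVn; apply: lie_algebra_scale; apply: hLohe.
  exact: mlg_exp.
by apply: cvgB; apply: f_mx_cvg; exact: majorized_in_group.
Qed.

End LieAlgebra.

(** * The derivative of g and the series of L_Y *)

Section Linearization.
Context {R : realType} {cplx : bool} {d n : nat}.
Local Notation K := (scalars R cplx).
Local Notation M := ('M[K]_d.+1).
Local Notation "x %:S" := (@of_real R cplx x) (at level 2, format "x %:S").
Implicit Types (a : nat -> R) (x y A B W Z D : M) (Y : 'I_n -> M).

Lemma mul_expr_swap x y q : (x * y) ^+ q * x = x * (y * x) ^+ q.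
Proof.
elim: q => [|q IHq]; first by rewrite !expr0 mul1r mulr1.
by rewrite exprS -mulrA IHq exprS !mulrA.
Qed.

(** Uses (xy)^q x = x (yx)^q on both sides of [W]: this is how the powers of
    B Y_j Y_i^-1 A^-1 become powers of Y_i^-1 A^-1 B Y_j around [W]. *)
Lemma ddiff_term_swap a x y W p :
  ddiff_term a (x * y) (x * y) (x * W * y) p =
  (a p)%:S *: (x * (\sum_(0 <= q < p) (y * x) ^+ q * W
                      * (y * x) ^+ (p - q - 1)) * y).
Proof.
rewrite /ddiff_term; congr (_ *: _); rewrite mulr_sumr mulr_suml.
apply: eq_bigr => q _; rewrite !mulrA mul_expr_swap.
by rewrite -[LHS]mulrA -[RHS]mulrA mul_expr_swap.
Qed.

(** The previous identity, with x = B Y_j and y = Y_i^-1 A^-1 in the first half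
    of the summand, x = A Y_i and y = Y_j^-1 B^-1 in the second. *)
Lemma LYij_seriesE a A B Y i j W N :
  LYij_series a A B Y i j W N =
  (Y i)^-1 *
    (series (ddiff_term a ((B * Y j) * ((Y i)^-1 * A^-1))
       ((B * Y j) * ((Y i)^-1 * A^-1)) (B * Y j * W * ((Y i)^-1 * A^-1))) N
     + series (ddiff_term a ((A * Y i) * ((Y j)^-1 * B^-1))
       ((A * Y i) * ((Y j)^-1 * B^-1)) (A * Y i * W * ((Y j)^-1 * B^-1))) N)
  * Y i.
Proof.
rewrite /LYij_series /series /=; case: N => [|N].
  by rewrite !big_geq // addr0 mulr0 mul0r.
have term0 U V H : ddiff_term a U V H 0 = 0 :> M.
  by rewrite /ddiff_term big_geq // scaler0.
rewrite -big_split /= [in RHS]big_ltn //= !term0 !add0r mulr_sumr mulr_suml.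
apply: eq_bigr => p _; rewrite !ddiff_term_swap -scalerDr -scalerAr -scalerAl.
by rewrite mulrDr mulrDl !mulrA.
Qed.

Lemma ddiff_mx_cvg a Z D : majorized_at a Z ->
  series (ddiff_term a Z Z D) @ \oo --> ddiff a Z Z D.
Proof.
by move=> /majorized_self[s [D0 [s0 sa bZ]]]; apply: (ddiff_cvg s0 sa bZ bZ).
Qed.

(** The curve X^-1 leaves (xy)^-1 with velocity
    - (xy)^-1 x W y (xy)^-1 = - y^-1 W x^-1, and the sign in g = f(X) - f(X^-1)
    makes the second term positive. *)
Lemma mderiv_g_mx a (X : R -> M) x y W : x \is a GRing.unit ->
  y \is a GRing.unit -> (forall s, X s \is a GRing.unit) -> X 0 = x * y ->
  majorized_at a (x * y) -> majorized_at a (x * y)^-1 ->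
  mderiv X 0 (x * W * y) ->
  mderiv (fun s => g_mx a (X s)) 0
    (ddiff a (x * y) (x * y) (x * W * y)
     + ddiff a (y^-1 * x^-1) (y^-1 * x^-1) (y^-1 * W * x^-1)).
Proof.
move=> ux uy uX X0 mxy mxyi XD; rewrite -invrM //.
have fX := mderiv_f_mx (a := a) _ XD.
have fXi := mderiv_f_mx (a := a) _ (mderivV uX XD).
rewrite !X0 in fX fXi; have {}fX := fX mxy; have {}fXi := fXi mxyi.
have := mderivD fX (mderivN fXi).
set E := - ((x * y)^-1 * _ * _).
have -> : E = (-1)%:S *: (y^-1 * W * x^-1).
  rewrite of_realN of_real1 scaleN1r /E invrM // !mulrA.
  by rewrite mulrVK // mulrK.
have [s [D0 [s0 sa bZ]]] := majorized_self mxyi.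
rewrite (ddiffZ _ _ s0 sa bZ bZ) of_realN of_real1 scaleN1r opprK.
exact.
Qed.

End Linearization.

(** * The operator L_Y on the Lie algebra *)

Section FrustratedLohe.
Context {R : realType} {cplx : bool} {d n : nat}.
Local Notation K := (scalars R cplx).
Local Notation M := ('M[K]_d.+1).
Local Notation "x %:S" := (@of_real R cplx x) (at level 2, format "x %:S").
Variables (G : set M) (hG : matrix_lie_group G) (hLohe : lohe_closed G).
Variables (a : nat -> R) (ha : analytic_on a G).
Variables (A B : M) (hA : G A) (hB : G B).
Variables (Y : 'I_n -> M) (hY : forall i, G (Y i)).

Let GV := mlg_inv hG.
Let GM := mlg_mul hG.
Let Gu := mlg_unit hG.

(** The derivative of g at x y in the direction x W y, see [mderiv_g_mx]. *)
Definition ddiff_pair (x y W : M) : M :=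
  ddiff a (x * y) (x * y) (x * W * y)
  + ddiff a (y^-1 * x^-1) (y^-1 * x^-1) (y^-1 * W * x^-1).

Lemma LYij_series_cvg i j W : LYij_series a A B Y i j W @ \oo -->
  (Y i)^-1 * ddiff_pair (B * Y j) ((Y i)^-1 * A^-1) W * Y i.
Proof.
rewrite (funext (LYij_seriesE a A B Y i j W)) /ddiff_pair.
have -> : ((Y i)^-1 * A^-1)^-1 = A * Y i by rewrite -invrM ?invrK ?Gu.
rewrite (invrM (Gu hB) (Gu (hY j))).
apply: cvg_mx_mul; last exact: cvg_cst.
apply: cvg_mx_mul; first exact: cvg_cst.
by apply: cvgD; apply: ddiff_mx_cvg; apply: (majorized_in_group hG ha);
  do ?[exact: hA | exact: hB | exact: hY | apply: GM | apply: GV].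
Qed.

Lemma LYijE i j W : LYij a A B Y i j W =
  (2^-1)%:S *:
    ((Y i)^-1 * ddiff_pair (B * Y j) ((Y i)^-1 * A^-1) W * Y i).
Proof. by rewrite /LYij (cvg_lim _ (@LYij_series_cvg i j W)). Qed.

Lemma mderiv_g_pair (X : R -> M) i j W :
  (forall s, X s \is a GRing.unit) -> X 0 = B * Y j * ((Y i)^-1 * A^-1) ->
  mderiv X 0 (B * Y j * W * ((Y i)^-1 * A^-1)) ->
  mderiv (fun s => g_mx a (X s)) 0
    (ddiff_pair (B * Y j) ((Y i)^-1 * A^-1) W).
Proof.
move=> uX X0 XD; have Gx : G (B * Y j) by exact: GM.
have Gy : G ((Y i)^-1 * A^-1) by apply: GM; exact: GV.
apply: mderiv_g_mx => //.
- exact: Gu.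
- exact: Gu.
- by apply: (majorized_in_group hG ha); exact: GM.
- by apply: (majorized_in_group hG ha); apply: GV; exact: GM.
Qed.

(** L_{Y,ij} W is half the conjugate by Y_i of the derivative at 0 of g along
    the curve B Y_j exp(h W) Y_i^-1 A^-1 of G, on which g is valued in the Lie
    algebra. *)
Lemma lie_algebra_LYij i j W : lie_algebra G W ->
  lie_algebra G (LYij a A B Y i j W).
Proof.
move=> GW; rewrite LYijE; apply: lie_algebra_scale; apply: lie_algebra_conj => //.
pose X h := B * Y j * mexp (h%:S *: W) * ((Y i)^-1 * A^-1).
have GX h : G (X h).
  by apply: (GM (GM (GM hB (hY j)) (GW h))); apply: GM; exact: GV.
apply: (@lie_algebra_mderiv _ _ _ _ hG (fun h => g_mx a (X h)) 0).
  by move=> h; exact: lie_algebra_g_mx.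
apply: mderiv_g_pair; first by move=> s; exact: Gu.
  by rewrite /X of_real0 scale0r mexp0 mulr1.
have := mderivM (mderivM (@mderiv_cst R cplx d (B * Y j) 0)
  (@mderiv_mexp_scale _ _ _ W)) (@mderiv_cst R cplx d ((Y i)^-1 * A^-1) 0).
by rewrite mul0r add0r mulr0 addr0.
Qed.

Lemma LYijD i j (W W' : M) : LYij a A B Y i j (W + W') =
  LYij a A B Y i j W + LYij a A B Y i j W'.
Proof.
rewrite !LYijE -scalerDr -mulrDl -mulrDr; congr (_ *: (_ * _ * _)).
have [Gx Gy] : G (B * Y j) /\ G ((Y i)^-1 * A^-1).
  by split; apply: GM => //; exact: GV.
have /majorized_self[s [D0 [s0 sa bZ]]] : majorized_at a
  (B * Y j * ((Y i)^-1 * A^-1)) by apply: (majorized_in_group hG ha); exact: GM.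
have /majorized_self[s' [D0' [s0' sa' bZ']]] : majorized_at a
    (((Y i)^-1 * A^-1)^-1 * (B * Y j)^-1).
  by apply: (majorized_in_group hG ha); apply: GM; exact: GV.
rewrite /ddiff_pair addrACA; congr (_ + _).
  by rewrite mulrDr mulrDl (ddiffD _ _ s0 sa bZ bZ).
by rewrite mulrDr mulrDl (ddiffD _ _ s0' sa' bZ' bZ').
Qed.

Lemma LYijZ i j (c : R) (W : M) : LYij a A B Y i j (c%:S *: W) =
  c%:S *: LYij a A B Y i j W.
Proof.
rewrite !LYijE scalerA -of_realM mulrC of_realM -scalerA; congr (_ *: _).
rewrite scalerAl scalerAr; congr (_ * _ * _).
have [Gx Gy] : G (B * Y j) /\ G ((Y i)^-1 * A^-1).
  by split; apply: GM => //; exact: GV.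
have /majorized_self[s [D0 [s0 sa bZ]]] : majorized_at a
  (B * Y j * ((Y i)^-1 * A^-1)) by apply: (majorized_in_group hG ha); exact: GM.
have /majorized_self[s' [D0' [s0' sa' bZ']]] : majorized_at a
    (((Y i)^-1 * A^-1)^-1 * (B * Y j)^-1).
  by apply: (majorized_in_group hG ha); apply: GM; exact: GV.
rewrite /ddiff_pair scalerDr; congr (_ + _).
  by rewrite -scalerAr -scalerAl (ddiffZ _ _ s0 sa bZ bZ).
by rewrite -scalerAr -scalerAl (ddiffZ _ _ s0' sa' bZ' bZ').
Qed.

Lemma LY_linear_operator (gamma : 'I_n -> 'I_n -> R) :
  linear_operator (lie_algebra_n0 G) (lie_algebra_n G) (LY gamma a A B Y).
Proof.
split=> [Q [GQ _] i|c Q P _ _ i].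
  apply: lie_algebra_sum => // j; apply: lie_algebra_scale.
  by apply: lie_algebra_LYij; apply: lie_algebraD => //; exact: lie_algebraN.
rewrite /LY scaler_sumr -big_split; apply: eq_bigr => j _ /=.
rewrite [c%:S *: (_ *: _)]scalerA mulrC -scalerA -scalerDr.
congr (_ *: _); rewrite -LYijZ -LYijD; congr LYij.
by rewrite scalerBr opprD addrACA.
Qed.

End FrustratedLohe.

(** * The first-order equation at a fixed point *)

Section FirstOrder.
Context {R : realType} {cplx : bool} {d n : nat}.
Local Notation K := (scalars R cplx).
Local Notation M := ('M[K]_d.+1).
Local Notation "x %:S" := (@of_real R cplx x) (at level 2, format "x %:S").
Variables (G : set M) (hG : matrix_lie_group G).
Variables (a : nat -> R) (ha : analytic_on a G).
Variables (A B : M) (hA : G A) (hB : G B).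
Variables (Y : 'I_n -> M) (hY : forall i, G (Y i)).
Variables (gamma : 'I_n -> 'I_n -> R) (Omega : 'I_n -> M).
Variables (Q : R -> 'I_n -> M) (hQ : forall s, lie_algebra_n G (Q s)).
Variable t : R.

Let GV := mlg_inv hG.
Let GM := mlg_mul hG.
Let Gu := mlg_unit hG.
Local Notation V := (frustrated_lohe gamma Omega a A B).

Lemma exp_coord_in_group eps i : G (exp_coord Y Q eps t i).
Proof. by apply: GM => //; exact: hQ. Qed.

Lemma exp_coord0 : exp_coord Y Q 0 t = Y.
Proof.
by apply/funext => i; rewrite /exp_coord of_real0 scale0r mexp0 mulr1.
Qed.

Lemma mderiv_exp_coord i :
  mderiv (fun eps => exp_coord Y Q eps t i) 0 (Y i * Q t i).
Proof.
have := mderivM (@mderiv_cst R cplx d (Y i) 0) (@mderiv_mexp_scale _ _ _ (Q t i)).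
by rewrite mul0r add0r.
Qed.

Lemma mderiv_coupling i j :
  mderiv (fun eps => B * exp_coord Y Q eps t j * (exp_coord Y Q eps t i)^-1
                     * A^-1) 0
    (B * Y j * (Q t j - Q t i) * ((Y i)^-1 * A^-1)).
Proof.
have uX k s : exp_coord Y Q s t k \is a GRing.unit.
  by apply: Gu; exact: exp_coord_in_group.
have := mderivM (mderivM (mderivM (@mderiv_cst R cplx d B 0)
  (@mderiv_exp_coord j)) (mderivV (uX i) (@mderiv_exp_coord i)))
  (@mderiv_cst R cplx d A^-1 0).
rewrite !exp_coord0 mulr0 addr0 mul0r add0r mulKr; last exact: Gu.
by rewrite mulrN mulrBr mulrBl !mulrBl !mulrA.
Qed.

Lemma mderiv_frustrated_lohe i :
  mderiv (fun eps => V (exp_coord Y Q eps t) i) 0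
    (Y i * LY gamma a A B Y (Q t) i * (Y i)^-1).
Proof.
have -> : Y i * LY gamma a A B Y (Q t) i * (Y i)^-1 =
    0 + (2^-1)%:S *: \sum_j (gamma i j)%:S *:
      (ddiff_pair a (B * Y j) ((Y i)^-1 * A^-1) (Q t j - Q t i) - 0).
  rewrite add0r /LY mulr_sumr mulr_suml scaler_sumr; apply: eq_bigr => j _.
  rewrite (LYijE hG ha hA hB hY) subr0 scalerA mulrC -scalerA -scalerAr -scalerAl.
  congr (_ *: _); rewrite -scalerAr -scalerAl; congr (_ *: _).
  rewrite !mulrA divrr ?mul1r; last exact: Gu.
  by rewrite mulrK //; exact: Gu.
apply: mderivD; first exact: mderiv_cst.
apply: mderivZ; apply: mderiv_sum => j; apply: mderivZ.
apply: mderivD; last by apply: mderivN; exact: mderiv_cst.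
apply: (mderiv_g_pair hG ha hA hB hY) => [s||].
- apply: Gu; apply: GM; last exact: GV.
  apply: GM; last by apply: GV; exact: exp_coord_in_group.
  by apply: GM => //; exact: exp_coord_in_group.
- by rewrite !exp_coord0 !mulrA.
- exact: mderiv_coupling.
Qed.

(** The time derivative of Y_i exp(eps Q_i), see [mderiv_exp_velocity]. *)
Definition exp_velocity (Q' : 'I_n -> M) (eps : R) (i : 'I_n) : M :=
  Y i * ddiff exp_weight (eps%:S *: Q t i) (eps%:S *: Q t i) (eps%:S *: Q' i).

Lemma mderiv_exp_velocity (Q' : 'I_n -> M) eps i :
  mderiv (Q ^~ i) t (Q' i) ->
  mderiv (fun s => exp_coord Y Q eps s i) t (exp_velocity Q' eps i).
Proof.
move=> /(mderivZ (c := eps))/mderiv_mexp QD.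
have := mderivM (@mderiv_cst R cplx d (Y i) t) QD.
by rewrite mul0r add0r.
Qed.

Lemma cvg_exp_coord i : exp_coord Y Q eps t i @[eps --> 0^'] --> Y i.
Proof.
have := mderiv_cvg (@mderiv_exp_coord i); rewrite exp_coord0.
by under eq_fun do rewrite add0r.
Qed.

(** The velocity is linear in eps Q', so after division by eps only the
    derivative of exp at eps Q, which tends to the identity, remains. *)
Lemma cvg_scaled_velocity (Q' : 'I_n -> M) i :
  (fun eps : R => (eps^-1)%:S *:
     (exp_velocity Q' eps i * (exp_coord Y Q eps t i)^-1)) @ 0^' -->
  Y i * Q' i * (Y i)^-1.
Proof.
apply: (@cvg_trans _ ((fun eps : R => Y i *
    ddiff exp_weight (eps%:S *: Q t i) (eps%:S *: Q t i) (Q' i) *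
    (exp_coord Y Q eps t i)^-1) @ 0^')).
  apply: near_eq_cvg; near=> eps.
  have eps0 : eps != 0 by near: eps; exact: (nbhs_dnbhs_neq (0 : R)).
  have [s [D [s0 sa bD]]] := majorized_self (majorized_exp (eps%:S *: Q t i)).
  rewrite /exp_velocity (ddiffZ _ _ s0 sa bD bD) -scalerAr -scalerAl scalerA.
  by rewrite -of_realM mulVf // of_real1 scale1r.
apply: cvg_mx_mul; last first.
  apply: cvg_mx_inv; last exact: cvg_exp_coord.
    by move=> s; apply: Gu; exact: exp_coord_in_group.
  exact: Gu.
apply: cvg_mx_mul; first exact: cvg_cst.
rewrite -[X in _ --> X]ddiff_exp00.
have cQ : (fun eps : R => eps%:S *: Q t i) @ 0^' --> (0 : M).
  rewrite -[X in _ --> X](scale0r (Q t i)) -of_real0.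
  by apply: cvg_mx_scale; [exact: cvg_within | exact: cvg_cst].
by apply: cvg_ddiff => //; [exact: majorized_exp | exact: cvg_cst].
Unshelve. all: by end_near. Qed.

(** Multiplied by eps^-1, the defect of the equation tends to
    Y_i (Q_i' - (L_Y Q)_i) Y_i^-1; it is o(eps) exactly when this vanishes.  The
    time derivatives in the definition are unique, so they may be taken to be
    [exp_velocity]. *)
Lemma first_order_solutionP (Q' : 'I_n -> M) : (forall i, V Y i = 0) ->
  (forall i, mderiv (Q ^~ i) t (Q' i)) ->
  first_order_solution V Y Q t <->
  (forall i, Q' i = LY gamma a A B Y (Q t) i).
Proof.
move=> VY0 QD.
have lim_defect i : (fun eps : R => (eps^-1)%:S *:
    (exp_velocity Q' eps i * (exp_coord Y Q eps t i)^-1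
     - V (exp_coord Y Q eps t) i)) @ 0^' -->
    Y i * (Q' i - LY gamma a A B Y (Q t) i) * (Y i)^-1.
  rewrite mulrBr mulrBl; under eq_fun do rewrite scalerBr.
  apply: cvgB; first exact: cvg_scaled_velocity.
  have := @mderiv_frustrated_lohe i; rewrite /mderiv exp_coord0 VY0.
  by under eq_fun do rewrite add0r subr0.
split=> [[dX dXD dX0] i | Q'E].
  have dXE eps j : dX eps j = exp_velocity Q' eps j.
    exact: (mderiv_unique (dXD eps j) (@mderiv_exp_velocity Q' eps j (QD j))).
  have := dX0 i; under eq_fun do rewrite dXE.
  move=> /(cvg_unique (@norm_hausdorff _ _) (lim_defect i)) e.
  apply/eqP; rewrite -subr_eq0; apply/eqP.
  apply: (mulrI (Gu (hY i))); apply: (mulIr (Gu (GV (hY i)))).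
  by rewrite e mulr0 mul0r.
exists (exp_velocity Q') => [eps i|i].
  exact: mderiv_exp_velocity.
by have := lim_defect i; rewrite Q'E subrr mulr0 mul0r.
Qed.

End FirstOrder.

Theorem proposition3p4 (R : realType) (cplx : bool) (d n : nat)
    (G : set 'M[scalars R cplx]_d.+1)
    (gamma : 'I_n -> 'I_n -> R) (Omega : 'I_n -> 'M[scalars R cplx]_d.+1)
    (a : nat -> R) (A B : 'M[scalars R cplx]_d.+1)
    (Y : 'I_n -> 'M[scalars R cplx]_d.+1)
    (hG : matrix_lie_group G) (hLohe : lohe_closed G)
    (gamma_sym : forall i j, gamma i j = gamma j i)
    (gamma_ge0 : forall i j, 0 <= gamma i j)
    (hOmega : lie_algebra_n G Omega)
    (ha : analytic_on a G) (hA : G A) (hB : G B)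
    (hY : fixed_point G (frustrated_lohe gamma Omega a A B) Y) :
  [/\ forall i j W, lie_algebra G W -> cvgn (LYij_series a A B Y i j W),
      linear_operator (lie_algebra_n0 G) (lie_algebra_n G)
        (LY gamma a A B Y) &
      is_linearization G (frustrated_lohe gamma Omega a A B) Y
        (LY gamma a A B Y)].
Proof.
have GY i : G (Y i) by have [] := hY 0 i.
have VY0 i : frustrated_lohe gamma Omega a A B Y i = 0.
  have [_ [D YD <-]] := hY 0 i.
  by rewrite (mderiv_unique YD (@mderiv_cst R cplx d (Y i) 0)) mul0r.
split=> [i j W _||Q t Q' hQ QD].
- by apply/cvgP; exact: (@LYij_series_cvg _ _ _ _ _ hG _ ha _ _ hA hB _ GY).
- exact: LY_linear_operator.
- exact: (first_order_solutionP hG ha hA hB GY hQ VY0 QD).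
Qed.
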